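(* Fix nonnegative rationals $\varepsilon,\delta$ with $\delta<2$, and nonnegative integers $M$, $N\ge1$, such that $\nu\varepsilon-(N-k)\delta+2\ne0$ for all $0\le\nu\le M$, $0\le k\le N-1$. For $b=(b',b'')=(b'_0,\dots,b'_M,b''_0,\dots,b''_N)\in\mathbb{C}^{M+N+2}$ with $b'\ne0$, let $P(b;Z)=\sum_\mu b'_\mu Z^\mu$, $Q(b;Z)=\sum_\nu b''_\nu Z^\nu$. Then there exist an ARP $T(B',B'')\in\mathbb{Z}|(B',B'')|$ and $s_1\in(0,1)$ such that for every such $b$ with $|||Q(b;Z)-Z^N|||<s_1$ and $Q(b;Z)$ having only simple roots, $b$ lies in the strict domain of $T$ and $$\int_B\frac{|P(b;z)|^\varepsilon}{|Q(b;z)|^\delta}\,dV\sim T(b),$$ with implied constants independent of $b$, where $B$ is the unit disk.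
   Context: An ARP in variables $X$ with integer coefficients is an expression $K(X)/L(X)$ with $K=(\sum_i|P_i(X)|^2)^{\varepsilon'/2}$, $L=(\sum_j|Q_j(X)|^2)^{\delta'/2}$, finitely many $P_i,Q_j\in\mathbb{Z}[X]$, not all $P_i$ zero, $\varepsilon',\delta'$ nonnegative rationals; its strict domain is where neither $K$ nor $L$ vanishes. For $Q(Z)=\sum_\mu b_\mu Z^\mu$, $|||Q|||=\sum_\mu|b_\mu|$. $dV$ is Lebesgue measure on $\mathbb{C}$; $\sim$ means two-sided bounds up to positive constants. *)

(* Defs.v *)
From HB Require Import structures.
From mathcomp Require Import all_boot all_order all_algebra.
From mathcomp Require Import all_classical all_reals all_analysis.
From mathcomp Require Import complex.

Set Implicit Arguments.
Unset Strict Implicit.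
Unset Printing Implicit Defensive.

Import Order.TTheory GRing.Theory Num.Theory.
Import numFieldNormedType.Exports.
Local Open Scope ring_scope.
Local Open Scope complex_scope.

(* A polynomial in [n] (complex) variables with integer coefficients, given
   as a finite list of terms (coefficient, exponent vector). *)
Definition intpoly (n : nat) := seq (int * (n.-tuple nat)).

Definition ipeval (R : rcfType) (n : nat) (p : intpoly n) (x : 'I_n -> R[i])
  : R[i] :=
  \sum_(t <- p) (t.1%:~R * \prod_(i < n) x i ^+ tnth t.2 i).

Definition ipcoef (n : nat) (p : intpoly n) (e : n.-tuple nat) : int :=
  \sum_(t <- p | t.2 == e) t.1.

Definition ip_is_zero (n : nat) (p : intpoly n) : bool :=
  all (fun t => ipcoef p t.2 == 0) p.

(* An ARP  K(X)/L(X), K = (sum_i |P_i|^2)^(eps'/2), L = (sum_j |Q_j|^2)^(delta'/2). *)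
Record ARP (n : nat) := MkARP {
  arp_P : seq (intpoly n);
  arp_Q : seq (intpoly n);
  arp_eps : rat;
  arp_delta : rat;
  arp_eps_ge0 : (0 <= arp_eps)%R;
  arp_delta_ge0 : (0 <= arp_delta)%R;
  arp_P_nz : exists2 p, p \in arp_P & ~~ ip_is_zero p
}.

Section ARPeval.
Variable R : realType.
Variable n : nat.

Definition arp_K (T : ARP n) (x : 'I_n -> R[i]) : R :=
  powR (\sum_(p <- arp_P T) Normc.normc (ipeval p x) ^+ 2)
       (ratr (arp_eps T) / 2).

Definition arp_L (T : ARP n) (x : 'I_n -> R[i]) : R :=
  powR (\sum_(q <- arp_Q T) Normc.normc (ipeval q x) ^+ 2)
       (ratr (arp_delta T) / 2).

Definition arp_eval (T : ARP n) (x : 'I_n -> R[i]) : R :=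
  arp_K T x / arp_L T x.

Definition arp_strict_dom (T : ARP n) (x : 'I_n -> R[i]) : Prop :=
  arp_K T x != 0 /\ arp_L T x != 0.
End ARPeval.

Definition tnorm (R : rcfType) (p : {poly R[i]}) : R :=
  \sum_(i < size p) Normc.normc p`_i.

Definition simple_roots (R : rcfType) (p : {poly R[i]}) : Prop :=
  forall z : R[i], root p z -> mup z p = 1%N.

Definition bcat (T : Type) (m k : nat) (b1 : 'I_m -> T) (b2 : 'I_k -> T)
  : 'I_(m + k) -> T :=
  fun i => match fintype.split i with inl j => b1 j | inr j => b2 j end.

Definition coefpoly (R : rcfType) (m : nat) (b : 'I_m -> R[i]) : {poly R[i]} :=
  \poly_(i < m) (if (i < m)%N =P true is ReflectT h then b (Ordinal h) else 0).

Definition unit_disk (R : realType) : set (R * R) :=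
  [set p | p.1 ^+ 2 + p.2 ^+ 2 < 1].

Definition lebC (R : realType) :=
  ((@lebesgue_measure R) \x (@lebesgue_measure R))%E.

Definition cplx (R : realType) (p : R * R) : R[i] := p.1 +i* p.2.

(* Main.v *)
From HB Require Import structures.
From mathcomp Require Import all_boot all_order all_fingroup all_algebra complex.
From mathcomp Require mpoly.
Require Import Defs.

Set Implicit Arguments.
Unset Strict Implicit.
Unset Printing Implicit Defensive.

Import Order.TTheory GRing.Theory Num.Theory.
Local Open Scope ring_scope.

(* Let [a_1, ..., a_N] be the roots of [Q].  For [z] closest to [a_i] and
   [r = |z - a_i|], the modulus of [Q z] is comparable to
   [\prod_j max r |a_i - a_j|], while the mean size of [P] at distance [r] from
   [a_i] is [\sum_nu |P^`N(nu)(a_i)| r^nu].  Between two consecutive distances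
   [|a_i - a_j|] the resulting radial weight is bounded by powers [r^sg], and
   [sg != -2] makes the integral of each power over an annulus comparable to its
   value at one of the two boundary scales.  Hence the integral is comparable to
   the sum over [i] and the scales [s = |a_i - a_l|] and [s = 2] of
     [(\sum_nu |P^`N(nu)(a_i)| s^nu)^eps s^2 / (\prod_j (s + |a_i - a_j|))^delta].
   A suitable power of that sum is a quotient of two sums of moduli of integer
   polynomials in the coefficients of [P] and the roots.  A sum of moduli
   [\sum |w|] is comparable to [(\sum_k |e_k(w)|^(2 n!/k))^(1/(2 n!))] by Cauchy's
   bound, and once the family is symmetrized over ['S_N] the elementary symmetric
   functions [e_k] are polynomials in the coefficients of [Q]. *)

(** * Integer polynomials in coefficients and roots *)

Lemma ipeval_eq0 (R : rcfType) n (p : intpoly n) (x : 'I_n -> R[i]) :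
  ip_is_zero p -> ipeval p x = 0.
Proof.
move=> /allP p0; pose monomial (e : n.-tuple nat) := \prod_(i < n) x i ^+ tnth e i.
pose exponents := undup [seq t.2 | t <- p].
transitivity (\sum_(t <- p) \sum_(e <- exponents | t.2 == e) t.1%:~R * monomial e).
  rewrite /ipeval big_seq [RHS]big_seq; apply: eq_bigr => t tp.
  rewrite [RHS]big_mkcond (bigD1_seq t.2) ?undup_uniq ?mem_undup ?map_f //= eqxx.
  by rewrite [X in _ + X]big1 ?addr0 // => e; rewrite eq_sym => /negPf ->.
rewrite (exchange_big_dep xpredT) //= big_seq big1 // => e.
rewrite mem_undup => /mapP[t tp ->]; rewrite -mulr_suml -rmorph_sum /=.
by rewrite -[\sum_(_ <- _ | _) _]/(ipcoef p t.2) (eqP (p0 _ tp)) mul0r.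
Qed.

(* [mpoly] is only imported inside sections closed before the analysis files are
   imported: the notations of the two libraries are incompatible. *)
Section MultivariatePolynomials.
Import mpoly.

Lemma mpoly_ring_ind (R : nzRingType) n (S : {mpoly R[n]} -> Prop) :
  (forall c, S c%:MP) -> (forall i, S 'X_i) ->
  (forall p q, S p -> S q -> S (p + q)) ->
  (forall p q, S p -> S q -> S (p * q)) -> forall p, S p.
Proof.
move=> SC SX SD SM p.
elim/mpolyind: p => [|c k p _ _ Sp]; first by rewrite -mpolyC0.
apply: SD => //; rewrite -mul_mpolyC mpolyXE_id; apply: (SM) => //.
elim/big_ind: _ => [||i _]; [by rewrite -mpolyC1|exact: SM|].
by elim: (k i) => [|j IH]; [rewrite expr0 -mpolyC1|rewrite exprS; exact: SM].
Qed.

Definition intpoly_of_mpoly n (p : {mpoly int[n]}) : intpoly n :=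
  [seq (p@_k, multinom_val k) | k <- msupp p].

Lemma ipeval_of_mpoly (R : rcfType) n (p : {mpoly int[n]}) (x : 'I_n -> R[i]) :
  ipeval (intpoly_of_mpoly p) x = mmap intr x p.
Proof. by rewrite /ipeval big_map. Qed.

(* The inner variables stand for the coefficients of [P], the outer ones for the
   roots of [Q] and, after symmetrization, for the coefficients of [Q]. *)
Definition bipoly (m n : nat) : Type := {mpoly {mpoly int[m]}[n]}.

HB.instance Definition _ m n := GRing.ComNzRing.on (bipoly m n).

Definition inner_var m n (i : 'I_m) : bipoly m n := ('X_i)%:MP.

Definition outer_var m n (j : 'I_n) : bipoly m n := 'X_j.

Definition bieval (C : comNzRingType) m n (b : 'I_m -> C) (a : 'I_n -> C) :
  bipoly m n -> C := mmap (mmap intr b) a.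

HB.instance Definition _ (C : comNzRingType) m n (b : 'I_m -> C) (a : 'I_n -> C) :=
  GRing.RMorphism.copy (bieval b a) (mmap (mmap intr b) a).

Lemma bieval_inner (C : comNzRingType) m n (b : 'I_m -> C) (a : 'I_n -> C) i :
  bieval b a (inner_var n i) = b i.
Proof. by rewrite /bieval /inner_var mmapC /= mmapX mmap1U. Qed.

Lemma bieval_outer (C : comNzRingType) m n (b : 'I_m -> C) (a : 'I_n -> C) j :
  bieval b a (outer_var m j) = a j.
Proof. by rewrite /bieval /outer_var mmapX mmap1U. Qed.

Lemma eq_bieval (C : comNzRingType) m n (b : 'I_m -> C) (a a' : 'I_n -> C) e :
  a =1 a' -> bieval b a e = bieval b a' e.
Proof.
move=> eq_a; apply: eq_bigr => k _; congr (_ * _).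
by apply: eq_bigr => i _; rewrite eq_a.
Qed.

Lemma bieval_mmap (C : comNzRingType) m n k (b : 'I_m -> C) (a : 'I_n -> C)
    (h : 'I_k -> bipoly m n) (p : bipoly m k) :
  bieval b a (mmap (@mpolyC n _) h p) = bieval b (bieval b a \o h) p.
Proof.
rewrite {1}/mmap rmorph_sum; apply: eq_bigr => e _.
rewrite rmorphM /= {1}/bieval mmapC; congr (_ * _).
by rewrite rmorph_prod; apply: eq_bigr => i _; rewrite rmorphXn.
Qed.

Lemma bipoly_ind m n (S : bipoly m n -> Prop) :
  (forall c : int, S c%:~R) -> (forall i, S (inner_var n i)) ->
  (forall j, S (outer_var m j)) ->
  (forall p q, S p -> S q -> S (p + q)) ->
  (forall p q, S p -> S q -> S (p * q)) -> forall p, S p.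
Proof.
move=> Sint Sin Sout SD SM; apply: mpoly_ring_ind => // q.
elim/mpoly_ring_ind: q => [c|//|p q Sp Sq|p q Sp Sq].
- by rewrite -[c]intz !rmorph_int.
- by rewrite mpolyCD; exact: SD.
- by rewrite mpolyCM; exact: SM.
Qed.

Lemma bieval_mesym (C : idomainType) m n (b : 'I_m -> C) (a : 'I_n -> C) (i : 'I_n) :
  bieval b a (mesym n _ i.+1) =
  (-1) ^+ i.+1 * (\prod_(j < n) ('X - (a j)%:P))`_(rev_ord i).
Proof.
have lt_i : (i.+1 < n.+1)%N by rewrite ltnS.
have := mroots_coeff [tuple a j | j < n] (Ordinal lt_i).
rewrite big_tuple /=; under eq_bigr do rewrite tnth_mktuple.
move=> ->; rewrite mulrA -exprMn mulrNN mul1r expr1n mul1r /mesym !rmorph_sum /=.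
apply: eq_bigr => S _; rewrite !rmorph_prod /=; apply: eq_bigr => j _.
by rewrite -[X in bieval _ _ X]/(outer_var m j) bieval_outer mevalXU tnth_mktuple.
Qed.

Lemma symmetric_bieval m n (p : bipoly m n) : p \is symmetric ->
  exists e : bipoly m n, forall (C : idomainType) (b : 'I_m -> C) (a : 'I_n -> C),
    bieval b a p = bieval b (fun j : 'I_n => (\prod_(i < n) ('X - (a i)%:P))`_j) e.
Proof.
move=> /sym_fundamental[t [<- _]].
pose signed_var (i : 'I_n) : bipoly m n := (-1) ^+ i.+1 * outer_var m (rev_ord i).
exists (mmap (@mpolyC n _) signed_var t) => C b a.
rewrite !bieval_mmap; apply: eq_bieval => i /=.
by rewrite tnth_mktuple bieval_mesym rmorphM rmorphXn rmorphN1 /= bieval_outer.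
Qed.

Lemma symmetrized_coef m n (s : seq (bipoly m n)) (k : nat) :
  exists e : bipoly m n, forall (C : idomainType) (b : 'I_m -> C) (a : 'I_n -> C),
    (\prod_(t : 'S_n) \prod_(x <- s) ('X - (bieval b (a \o t) x)%:P))`_k =
    bieval b (fun j : 'I_n => (\prod_(i < n) ('X - (a i)%:P))`_j) e.
Proof.
pose G : {poly bipoly m n} :=
  \prod_(t : 'S_n) \prod_(x <- s) ('X - (msym t x)%:P).
have symG : G`_k \is symmetric.
  apply/issymP => u; rewrite -coef_map; congr ((polyseq _)`_k).
  rewrite /G rmorph_prod /= [RHS](reindex_inj (mulIg u)) /=.
  apply: eq_bigr => t _; rewrite rmorph_prod; apply: eq_bigr => x _.
  by rewrite rmorphB /= map_polyX map_polyC /= msymMm.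
have [e bieval_e] := symmetric_bieval symG.
exists e => C b a; rewrite -bieval_e -coef_map; congr ((polyseq _)`_k).
rewrite /G rmorph_prod; apply: eq_bigr => t _.
rewrite rmorph_prod; apply: eq_bigr => x _.
rewrite rmorphB /= map_polyX map_polyC /= bieval_mmap.
by congr ('X - _%:P); apply: eq_bieval => i /=; rewrite bieval_outer.
Qed.

Lemma bipoly_homogenization m n (e : bipoly m n) :
  exists (D : nat) (p : intpoly (m + n.+1)),
  forall (R : rcfType) (b1 : 'I_m -> R[i]) (b2 : 'I_n.+1 -> R[i]),
    b2 ord_max != 0 ->
    ipeval p (bcat b1 b2) =
    b2 ord_max ^+ D *
    bieval b1 (fun j => b2 (widen_ord (leqnSn n) j) / b2 ord_max) e.
Proof.
suff [D [p ipevalE]] : exists (D : nat) (p : {mpoly int[m + n.+1]}),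
    forall (R : rcfType) (b1 : 'I_m -> R[i]) (b2 : 'I_n.+1 -> R[i]),
    b2 ord_max != 0 ->
    mmap intr (bcat b1 b2) p = b2 ord_max ^+ D *
      bieval b1 (fun j => b2 (widen_ord (leqnSn n) j) / b2 ord_max) e.
  by exists D, (intpoly_of_mpoly p) => R b1 b2 b20; rewrite ipeval_of_mpoly ipevalE.
have bcat_l (R : rcfType) (b1 : 'I_m -> R[i]) (b2 : 'I_n.+1 -> R[i]) j :
    mmap intr (bcat b1 b2) 'X_(lshift _ j) = b1 j.
  by rewrite mmapX mmap1U /bcat -[lshift _ j]/(unsplit (inl j)) unsplitK.
have bcat_r (R : rcfType) (b1 : 'I_m -> R[i]) (b2 : 'I_n.+1 -> R[i]) j :
    mmap intr (bcat b1 b2) 'X_(rshift _ j) = b2 j.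
  by rewrite mmapX mmap1U /bcat -[rshift m j]/(unsplit (inr j)) unsplitK.
elim/bipoly_ind: e => [c|i|j|e1 e2 [D1 [p1 p1E]] [D2 [p2 p2E]]|
                        e1 e2 [D1 [p1 p1E]] [D2 [p2 p2E]]].
- by exists 0%N, c%:~R => R b1 b2 _; rewrite !rmorph_int mul1r.
- by exists 0%N, 'X_(lshift _ i) => R b1 b2 _; rewrite bcat_l bieval_inner mul1r.
- exists 1%N, 'X_(rshift m (widen_ord (leqnSn n) j)) => R b1 b2 b20.
  by rewrite bcat_r bieval_outer mulrC divfK.
- pose v : {mpoly int[m + n.+1]} := 'X_(rshift m ord_max).
  exists (D1 + D2)%N, (v ^+ D2 * p1 + v ^+ D1 * p2) => R b1 b2 b20.
  rewrite !(rmorphD, rmorphM, rmorphXn) /= bcat_r p1E // p2E // mulrDr !mulrA.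
  by rewrite -!exprD addnC.
- exists (D1 + D2)%N, (p1 * p2) => R b1 b2 b20.
  by rewrite !rmorphM /= p1E // p2E // exprD mulrACA.
Qed.

End MultivariatePolynomials.

From mathcomp Require Import all_classical all_reals all_analysis.
From mathcomp Require Import measurable_realfun.
From mathcomp Require Import ring lra.

Import numFieldNormedType.Exports.
Local Notation normc := Normc.normc.

(** * Comparability up to constants *)

Section Comparability.
Variables (R : realType) (T : Type).
Implicit Types (D : set T) (f g h : T -> R).

Definition dominated D f g : Prop :=
  exists2 C : R, 0 < C & forall x, D x -> 0 <= f x <= C * g x.

Definition asymp D f g : Prop := dominated D f g /\ dominated D g f.

Lemma dominated_trans D f g h :
  dominated D f g -> dominated D g h -> dominated D f h.
Proof.
move=> [C C0 fg] [C' C'0 gh]; exists (C * C'); first exact: mulr_gt0.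
move=> x Dx; have /andP[-> le_fg] := fg x Dx; have /andP[_ le_gh] := gh x Dx.
by apply: le_trans le_fg _; rewrite -mulrA ler_pM2l.
Qed.

Lemma dominatedM D f f' g g' : dominated D f g -> dominated D f' g' ->
  dominated D (fun x => f x * f' x) (fun x => g x * g' x).
Proof.
move=> [C C0 fg] [C' C'0 fg']; exists (C * C'); first exact: mulr_gt0.
move=> x Dx; have /andP[f0 le_fg] := fg x Dx; have /andP[f'0 le_fg'] := fg' x Dx.
by rewrite mulr_ge0 //= mulrACA ler_pM.
Qed.

Lemma dominatedX D f g n : dominated D f g ->
  dominated D (fun x => f x ^+ n) (fun x => g x ^+ n).
Proof.
move=> [C C0 fg]; exists (C ^+ n); first exact: exprn_gt0.
move=> x Dx; have /andP[f0 le_fg] := fg x Dx.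
by rewrite exprn_ge0 //= -exprMn lerXn2r // nnegrE (le_trans f0).
Qed.

Lemma dominated_powR D f g r : 0 <= r -> dominated D f g ->
  dominated D (fun x => f x `^ r) (fun x => g x `^ r).
Proof.
move=> r0 [C C0 fg]; exists (C `^ r); first exact: powR_gt0.
move=> x Dx; have /andP[f0 le_fg] := fg x Dx.
have Cg0 : 0 <= C * g x by exact: le_trans le_fg.
rewrite powR_ge0 /= -powRM ?(ltW C0) //; last by rewrite -(pmulr_rge0 _ C0).
by apply: ge0_ler_powR; rewrite ?nnegrE.
Qed.

Lemma dominatedD D f f' g g' : dominated D f g -> dominated D f' g' ->
  dominated D (fun x => f x + f' x) (fun x => g x + g' x).
Proof.
move=> [C C0 fg] [C' C'0 fg']; exists (C + C'); first exact: addr_gt0.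
move=> x Dx; have /andP[f0 le_fg] := fg x Dx; have /andP[f'0 le_fg'] := fg' x Dx.
have g0 : 0 <= g x by rewrite -(pmulr_rge0 _ C0) (le_trans f0).
have g'0 : 0 <= g' x by rewrite -(pmulr_rge0 _ C'0) (le_trans f'0).
rewrite addr_ge0 //= mulrDr lerD // (le_trans le_fg, le_trans le_fg') //.
  by rewrite ler_wpM2r // lerDl ltW.
by rewrite ler_wpM2r // lerDr ltW.
Qed.

Lemma dominated_sum D (I : Type) (r : seq I) (f g : I -> T -> R) :
  (forall i, dominated D (f i) (g i)) ->
  dominated D (fun x => \sum_(i <- r) f i x) (fun x => \sum_(i <- r) g i x).
Proof.
move=> fg; elim: r => [|i r IH].
  by exists 1 => // x _; rewrite !big_nil mulr0 lexx.
have [C C0 le_fg] := dominatedD (fg i) IH.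
by exists C => // x Dx; rewrite !big_cons; exact: le_fg.
Qed.

Lemma eq_dominated D f f' g g' : (forall x, D x -> f x = f' x) ->
  (forall x, D x -> g x = g' x) -> dominated D f' g' -> dominated D f g.
Proof.
move=> ff' gg' [C C0 le_fg]; exists C => // x Dx.
by rewrite ff' // gg' //; exact: le_fg.
Qed.

Lemma asymp_refl D f : (forall x, D x -> 0 <= f x) -> asymp D f f.
Proof.
by move=> f0; split; exists 1 => // x /f0 fx0; rewrite fx0 mul1r lexx.
Qed.

Lemma asymp_sym D f g : asymp D f g -> asymp D g f.
Proof. by case. Qed.

Lemma asymp_trans D f g h : asymp D f g -> asymp D g h -> asymp D f h.
Proof.
move=> [fg gf] [gh hg].
by split; [exact: dominated_trans fg gh|exact: dominated_trans hg gf].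
Qed.

Lemma asympM D f f' g g' : asymp D f g -> asymp D f' g' ->
  asymp D (fun x => f x * f' x) (fun x => g x * g' x).
Proof. by move=> [fg gf] [fg' gf']; split; exact: dominatedM. Qed.

Lemma asympX D f g n : asymp D f g ->
  asymp D (fun x => f x ^+ n) (fun x => g x ^+ n).
Proof. by move=> [fg gf]; split; exact: dominatedX. Qed.

Lemma asymp_powR D f g r : 0 <= r -> asymp D f g ->
  asymp D (fun x => f x `^ r) (fun x => g x `^ r).
Proof. by move=> r0 [fg gf]; split; exact: dominated_powR. Qed.

(* Both functions vanish at the same points, so [0^-1 = 0] does no harm. *)
Lemma asympV D f g : asymp D f g -> asymp D (fun x => (f x)^-1) (fun x => (g x)^-1).
Proof.
suff inv f' g' : asymp D f' g' ->
    dominated D (fun x => (f' x)^-1) (fun x => (g' x)^-1).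
  by move=> fg; split; apply: inv => //; exact: asymp_sym.
move=> [[C C0 fg] [C' C'0 gf]]; exists C' => // x Dx.
have /andP[f0 le_fg] := fg x Dx; have /andP[g0 le_gf] := gf x Dx.
rewrite invr_ge0 f0 /=; have [->|f_neq0] := eqVneq (f' x) 0.
  by rewrite invr0 mulr_ge0 ?invr_ge0 // ltW.
have f_gt0 : 0 < f' x by rewrite lt_def f_neq0.
have g_gt0 : 0 < g' x by rewrite -(pmulr_rgt0 _ C0) (lt_le_trans f_gt0).
by rewrite ler_pdivlMr // ler_pdivrMl // mulrC.
Qed.

Lemma asymp_sum D (I : Type) (r : seq I) (f g : I -> T -> R) :
  (forall i, asymp D (f i) (g i)) ->
  asymp D (fun x => \sum_(i <- r) f i x) (fun x => \sum_(i <- r) g i x).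
Proof. by move=> fg; split; apply: dominated_sum => i; have [] := fg i. Qed.

Lemma eq_asymp D f f' g g' : (forall x, D x -> f x = f' x) ->
  (forall x, D x -> g x = g' x) -> asymp D f' g' -> asymp D f g.
Proof.
move=> ff' gg' [fg gf]; split; first exact: eq_dominated fg.
exact: eq_dominated gf.
Qed.

Lemma asymp_gt0 D f g x : asymp D f g -> D x -> 0 < g x -> 0 < f x.
Proof.
move=> [_ [C C0 gf]] Dx g0; have /andP[_ le_gf] := gf x Dx.
by rewrite -(pmulr_rgt0 _ C0) (lt_le_trans g0).
Qed.

End Comparability.

Lemma asymp_comp (R : realType) (T U : Type) (D : set T) (E : set U) (phi : U -> T)
    (f g : T -> R) : (forall u, E u -> D (phi u)) -> asymp D f g ->
  asymp E (f \o phi) (g \o phi).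
Proof.
move=> ED [[C C0 fg] [C' C'0 gf]].
by split; [exists C|exists C'] => // u /ED; [exact: fg|exact: gf].
Qed.

Lemma asymp_power_sum (R : realType) (T : Type) (D : set T) (J : finType) (j0 : J)
    (t : J -> T -> R) m : (forall j x, D x -> 0 <= t j x) ->
  asymp D (fun x => (\sum_j t j x) ^+ m) (fun x => \sum_j t j x ^+ m).
Proof.
move=> t0; have J_gt0 : 0 < #|J|%:R :> R.
  by rewrite ltr0n; apply/card_gt0P; exists j0.
have sum_ge0 x (P : pred J) : D x -> 0 <= \sum_(j | P j) t j x.
  by move=> Dx; apply: sumr_ge0 => j _; exact: t0.
have sumX_ge0 x (P : pred J) : D x -> 0 <= \sum_(j | P j) t j x ^+ m.
  by move=> Dx; apply: sumr_ge0 => j _; rewrite exprn_ge0 ?t0.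
split.
  exists (#|J|%:R ^+ m) => [|x Dx]; first exact: exprn_gt0.
  rewrite exprn_ge0 ?sum_ge0 //=.
  have [j _ t_max] := @arg_maxP _ _ _ j0 xpredT (fun j => t j x) isT.
  apply: (@le_trans _ _ ((#|J|%:R * t j x) ^+ m)).
    rewrite lerXn2r ?nnegrE ?mulr_ge0 ?sum_ge0 ?t0 //.
    by rewrite mulr_natl -sumr_const; apply: ler_sum => i _; exact: t_max.
  by rewrite exprMn ler_wpM2l ?exprn_ge0 // (bigD1 j) //= lerDl sumX_ge0.
exists #|J|%:R => // x Dx; rewrite sumX_ge0 //= mulr_natl -sumr_const.
apply: ler_sum => j _; rewrite lerXn2r ?nnegrE ?sum_ge0 ?t0 //.
by rewrite (bigD1 j) //= lerDl sum_ge0.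
Qed.

(** * Modulus and coefficients of complex polynomials *)

Section Modulus.
Variable R : rcfType.
Implicit Types z w : R[i].

Lemma normc_ge0 z : 0 <= normc z.
Proof. by case: z => a b; rewrite sqrtr_ge0. Qed.

Lemma normc_eq0 z : (normc z == 0) = (z == 0).
Proof.
by apply/eqP/eqP => [/Normc.eq0_normc //|->]; rewrite Normc.normc0.
Qed.

Lemma normc_gt0 z : (0 < normc z) = (z != 0).
Proof. by rewrite lt_def normc_ge0 andbT normc_eq0. Qed.

Lemma normcX z n : normc (z ^+ n) = normc z ^+ n.
Proof.
elim: n => [|n IH]; first by rewrite !expr0 Normc.normc1.
by rewrite !exprS Normc.normcM IH.
Qed.

Lemma normc_prod (I : Type) (r : seq I) (P : pred I) (F : I -> R[i]) :
  normc (\prod_(i <- r | P i) F i) = \prod_(i <- r | P i) normc (F i).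
Proof. exact: (big_morph _ (@Normc.normcM R) (Normc.normc1 R)). Qed.

Lemma le_normc_sum (I : Type) (r : seq I) (P : pred I) (F : I -> R[i]) :
  normc (\sum_(i <- r | P i) F i) <= \sum_(i <- r | P i) normc (F i).
Proof.
elim/big_rec2: _ => [|i y x _ le_xy]; first by rewrite Normc.normc0.
by apply: le_trans (le_normcD _ _) _; rewrite lerD2l.
Qed.

Lemma le_normcB z w : normc (z - w) <= normc z + normc w.
Proof. by apply: le_trans (le_normcD _ _) _; rewrite normcN. Qed.

Lemma normc_distC z w : normc (z - w) = normc (w - z).
Proof. by rewrite -normcN opprB. Qed.

Lemma le_normc_dist u z w : normc (z - w) <= normc (z - u) + normc (u - w).
Proof. by rewrite -{1}(subrK u z) -addrA le_normcD. Qed.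

Lemma normc_real (r : R) : normc (r%:C)%C = `|r|.
Proof. by rewrite /= expr0n addr0 sqrtr_sqr. Qed.

Lemma le_norm_Re z : `|complex.Re z| <= normc z.
Proof. by case: z => a b /=; rewrite -sqrtr_sqr ler_wsqrtr // lerDl sqr_ge0. Qed.

Lemma le_norm_Im z : `|complex.Im z| <= normc z.
Proof. by case: z => a b /=; rewrite -sqrtr_sqr ler_wsqrtr // lerDr sqr_ge0. Qed.

Lemma le_normc_Re_Im z : normc z <= `|complex.Re z| + `|complex.Im z|.
Proof.
case: z => a b /=; rewrite -[leRHS]ger0_norm ?addr_ge0 // -[leRHS]sqrtr_sqr.
rewrite ler_wsqrtr // sqrrD !real_normK ?num_real // lerD2r lerDl.
by rewrite mulrn_wge0 // mulr_ge0.
Qed.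

End Modulus.

Section CoefficientNorm.
Variable R : rcfType.
Implicit Types (p q : {poly R[i]}) (z w : R[i]).

Lemma tnorm_widen p n : (size p <= n)%N -> tnorm p = \sum_(k < n) normc p`_k.
Proof.
move=> le_pn; rewrite /tnorm (big_ord_widen n (fun k => normc p`_k)) // big_mkcond.
apply: eq_bigr => k _; case: ltnP => // le_pk.
by rewrite nth_default // Normc.normc0.
Qed.

Lemma tnorm_ge0 p : 0 <= tnorm p.
Proof. by apply: sumr_ge0 => k _; exact: normc_ge0. Qed.

Lemma le_normc_coef_tnorm p k : normc p`_k <= tnorm p.
Proof.
rewrite (tnorm_widen (leq_maxl (size p) k.+1)).
rewrite (bigD1 (Ordinal (leq_maxr (size p) k.+1))) //= lerDl.
by apply: sumr_ge0 => i _; exact: normc_ge0.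
Qed.

Lemma le_tnormD p q : tnorm (p + q) <= tnorm p + tnorm q.
Proof.
set n := maxn (size p) (size q).
rewrite (@tnorm_widen p n) ?leq_maxl // (@tnorm_widen q n) ?leq_maxr //.
rewrite (@tnorm_widen (p + q) n) ?size_polyD // -big_split /=.
by apply: ler_sum => k _; rewrite coefD le_normcD.
Qed.

Lemma tnormC z : tnorm z%:P = normc z.
Proof.
by rewrite (tnorm_widen (size_polyC_leq1 z)) big_ord1 coefC.
Qed.

Lemma tnormMX p : tnorm (p * 'X) = tnorm p.
Proof.
have [->|p0] := eqVneq p 0; first by rewrite mul0r.
rewrite (@tnorm_widen (p * 'X) (size p).+1) ?size_mulX // big_ord_recl.
rewrite coefMX Normc.normc0 add0r.
by apply: eq_bigr => k _; rewrite coefMX.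
Qed.

Lemma tnormZ z p : tnorm (z *: p) = normc z * tnorm p.
Proof.
rewrite (tnorm_widen (size_scale_leq z p)) mulr_sumr.
by apply: eq_bigr => k _; rewrite coefZ Normc.normcM.
Qed.

Lemma le_tnorm_mulXsubC p w : tnorm (p * ('X - w%:P)) <= (1 + normc w) * tnorm p.
Proof.
rewrite mulrBr -mulrN -polyCN [p * _%:P]mulrC mul_polyC.
by apply: le_trans (le_tnormD _ _) _; rewrite tnormMX tnormZ normcN mulrDl mul1r.
Qed.

Lemma le_normc_horner p n z : (size p <= n.+1)%N ->
  normc p.[z] <= tnorm p * Num.max 1 (normc z) ^+ n.
Proof.
move=> le_pn; rewrite (horner_coef_wide _ le_pn) (tnorm_widen le_pn) mulr_suml.
apply: le_trans (le_normc_sum _ _ _) _; apply: ler_sum => k _.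
rewrite Normc.normcM normcX ler_wpM2l ?normc_ge0 //.
apply: (@le_trans _ _ (Num.max 1 (normc z) ^+ k)).
  by rewrite lerXn2r ?nnegrE ?normc_ge0 ?le_max ?lexx ?ler01 ?orbT.
by rewrite ler_weXn2l ?le_max ?lexx // -ltnS.
Qed.

End CoefficientNorm.

(** * Symmetric functions of complex families *)

Section CoefficientsOfRoots.
Variable R : realType.
Implicit Types (s : seq R[i]) (p : {poly R[i]}).

Lemma le_normc_coef_prod_XsubC s (S : R) k : (forall w, w \in s -> normc w <= S) ->
  normc (\prod_(w <- s) ('X - w%:P))`_k <= 'C(size s, k)%:R * S ^+ (size s - k).
Proof.
elim: s k => [|w s IH] k le_sS.
  rewrite big_nil coefC.
  by case: k => [|k]; rewrite ?Normc.normc1 ?Normc.normc0 mulr1.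
have le_wS : normc w <= S by rewrite le_sS ?mem_head.
have {}IH j := IH j (fun u us => le_sS u (@mem_behead _ (w :: s) u us)).
have IHw j : normc (w * (\prod_(u <- s) ('X - u%:P))`_j) <=
    'C(size s, j)%:R * (S * S ^+ (size s - j)).
  by rewrite Normc.normcM mulrCA ler_pM ?normc_ge0.
rewrite big_cons mulrBl coefB coefXM coefCM; apply: le_trans (le_normcB _ _) _.
case: k => [|k].
  by have := IHw 0%N; rewrite eqxx Normc.normc0 add0r !bin0 !subn0 exprS.
rewrite /= binS natrD mulrDl addrC subSS lerD ?IH //; apply: le_trans (IHw _) _.
have [lt_ks|le_sk] := ltnP k (size s); first by rewrite -exprS subnSK.
by rewrite bin_small ?mul0r.
Qed.

Lemma cauchy_root_bound p (rho : R) w : p \is monic -> root p w -> 0 <= rho ->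
  (forall k, (k < (size p).-1)%N -> normc p`_k <= rho ^+ ((size p).-1 - k)) ->
  normc w <= 2 * rho.
Proof.
set n := (size p).-1 => p_monic /rootP pw rho0 le_coef.
have size_p : size p = n.+1 by rewrite prednK // size_poly_gt0 monic_neq0.
have lead_p : p`_n = 1 by move: p_monic; rewrite monicE lead_coefE => /eqP.
set t := normc w; pose A := \sum_(k < n) t ^+ (n.-1 - k) * rho ^+ k.
rewrite leNgt; apply/negP => lt_rho_t.
have t_gt0 : 0 < t by apply: le_lt_trans lt_rho_t; rewrite mulr_ge0.
have le_tn : t ^+ n <= rho * A.
  rewrite -normcX -normcN.
  have -> : - w ^+ n = \sum_(k < n) p`_k * w ^+ k.
    move: pw; rewrite horner_coef size_p big_ord_recr /= lead_p mul1r => /eqP.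
    by rewrite addr_eq0 => /eqP ->.
  apply: le_trans (le_normc_sum _ _ _) _.
  rewrite mulr_sumr [leRHS](reindex_inj rev_ord_inj); apply: ler_sum => k _ /=.
  have kn := ltn_ord k; rewrite Normc.normcM normcX mulrCA -exprS mulrC subnSK //.
  rewrite -subn1 subnAC subKn // subn1 /=.
  by rewrite ler_wpM2l ?le_coef // exprn_ge0 ?normc_ge0.
have geometric : (t - rho) * A = t ^+ n - rho ^+ n by rewrite subrXX.
have A_le0 : A <= 0.
  have gap0 : 0 < t - 2 * rho by rewrite subr_gt0.
  by rewrite -(pmulr_rle0 _ gap0); have := exprn_ge0 n rho0; lra.
have := lt_le_trans (exprn_gt0 n t_gt0) le_tn.
by rewrite ltNge mulr_ge0_le0.
Qed.

Definition coef_power_sum n p : R :=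
  \sum_(k < n) normc p`_k ^+ (2 * (n`! %/ (n - k))).

Lemma mul_fact_div n k : (k < n)%N -> ((n - k) * (n`! %/ (n - k)) = n`!)%N.
Proof. by move=> kn; rewrite mulnC divnK // dvdn_fact // subn_gt0 kn leq_subr. Qed.

Lemma sum_normc_le_coef_power_sum n s : size s = n ->
  \sum_(w <- s) normc w <=
  2 * n%:R * coef_power_sum n (\prod_(w <- s) ('X - w%:P)) `^ (2 * n`!)%:R^-1.
Proof.
move=> size_s; set p := \prod_(w <- s) _; set E := coef_power_sum n p.
have E_ge0 : 0 <= E by apply: sumr_ge0 => k _; rewrite exprn_ge0 ?normc_ge0.
have fact0 : (0 < 2 * n`!)%N by rewrite muln_gt0 fact_gt0.
set rho := E `^ _; have rho0 : 0 <= rho by exact: powR_ge0.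
have rhoX : rho ^+ (2 * n`!) = E.
  by rewrite -powR_mulrn // -powRrM mulVf ?powRr1 // pnatr_eq0 -lt0n.
have size_p : size p = n.+1 by rewrite size_prod_XsubC size_s.
rewrite -mulrA mulrCA -size_s.
apply: (@le_trans _ _ (\sum_(w <- s) (2 * rho))); last first.
  by rewrite big_const_seq count_predT iter_addr_0 [leRHS]mulr_natl.
rewrite big_seq [leRHS]big_seq; apply: ler_sum => w ws.
apply: (@cauchy_root_bound p) => //; first exact: monic_prod_XsubC.
  by rewrite root_prod_XsubC.
rewrite size_p => k kn; set d := (n`! %/ (n - k))%N.
have d0 : (0 < d)%N.
  by have := fact_gt0 n; rewrite -(mul_fact_div kn) muln_gt0 => /andP[].
rewrite -(@ler_pXn2r _ (2 * d)%N) ?muln_gt0 ?d0 ?nnegrE ?normc_ge0 ?exprn_ge0 //.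
rewrite -exprM mulnCA mul_fact_div // rhoX.
rewrite /E /coef_power_sum (bigD1 (Ordinal kn)) //=.
by rewrite lerDl sumr_ge0 // => j _; rewrite exprn_ge0 ?normc_ge0.
Qed.

Lemma sum_normc_asymp n :
  asymp (fun s => size s = n)
    (fun s => coef_power_sum n (\prod_(w <- s) ('X - w%:P)))
    (fun s => (\sum_(w <- s) normc w) ^+ (2 * n`!)).
Proof.
have sum_ge0 s : 0 <= \sum_(w <- s) normc w.
  by apply: sumr_ge0 => w _; exact: normc_ge0.
split; last first.
  have dom : dominated (fun s => size s = n) (fun s => \sum_(w <- s) normc w)
      (fun s => coef_power_sum n (\prod_(w <- s) ('X - w%:P)) `^ (2 * n`!)%:R^-1).
    exists (2 * n.+1%:R) => [|s size_s]; first by rewrite mulr_gt0.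
    rewrite sum_ge0; apply: le_trans (sum_normc_le_coef_power_sum size_s) _.
    by rewrite ler_wpM2r ?powR_ge0 // ler_pM2l // ler_nat.
  apply: eq_dominated (dominatedX (2 * n`!) dom) => // s _.
  rewrite -powR_mulrn ?powR_ge0 // -powRrM mulVf.
    by rewrite powRr1 //; apply: sumr_ge0 => k _; rewrite exprn_ge0 ?normc_ge0.
  by rewrite pnatr_eq0 -lt0n muln_gt0 fact_gt0.
exists (1 + \sum_(k < n) 'C(n, k)%:R ^+ (2 * (n`! %/ (n - k)))) => [|s size_s].
  by rewrite ltr_pwDl // sumr_ge0.
rewrite sumr_ge0 /= => [|k _]; last by rewrite exprn_ge0 ?normc_ge0.
set S := \sum_(w <- s) normc w; have S_ge0 : 0 <= S by exact: sum_ge0.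
rewrite mulrDl mul1r ler_wpDl ?exprn_ge0 //.
rewrite mulr_suml; apply: ler_sum => k _.
rewrite -[in S ^+ _](mul_fact_div (ltn_ord k)).
rewrite mulnCA [_ ^+ ((n - k) * _)]exprM -exprMn lerXn2r ?nnegrE ?normc_ge0 //.
  by rewrite mulr_ge0 ?exprn_ge0.
have := @le_normc_coef_prod_XsubC s S k; rewrite size_s; apply => w ws.
by rewrite /S (big_rem w) //= lerDl sumr_ge0 // => u _; exact: normc_ge0.
Qed.

End CoefficientsOfRoots.

Section SymmetrizedFamilies.
Variables (R : realType) (m n : nat) (T : Type) (D : set T).
Variables (b1 : T -> 'I_m -> R[i]) (b2 : T -> 'I_n.+1 -> R[i]).
Variable a : T -> 'I_n -> R[i].
Hypothesis lead_asymp1 : asymp D (fun x => normc (b2 x ord_max)) (fun=> 1).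
Hypothesis roots_a : forall x j, D x ->
  b2 x (widen_ord (leqnSn n) j) / b2 x ord_max =
  (\prod_(i < n) ('X - (a x i)%:P))`_j.

Definition abs_sum (s : seq (bipoly m n)) (b : 'I_m -> R[i]) (c : 'I_n -> R[i])
    : R :=
  \sum_(e <- s) normc (bieval b c e).

Definition sym_abs_sum s b (c : 'I_n -> R[i]) : R :=
  \sum_(t : 'S_n) abs_sum s b (c \o t).

Lemma symmetrized_coef_asymp (s : seq (bipoly m n)) k d :
  exists p : intpoly (m + n.+1),
    asymp D (fun x => normc (ipeval p (bcat (b1 x) (b2 x))) ^+ 2)
      (fun x => normc (\prod_(t : 'S_n) \prod_(e <- s)
         ('X - (bieval (b1 x) (a x \o t) e)%:P))`_k ^+ (2 * d)).
Proof.
have [e bieval_e] := symmetrized_coef s k.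
have [h [p ipevalE]] := bipoly_homogenization (e ^+ d).
exists p; pose c x := (\prod_(t : 'S_n) \prod_(e <- s)
  ('X - (bieval (b1 x) (a x \o t) e)%:P))`_k.
have lead_neq0 x : D x -> b2 x ord_max != 0.
  by move=> Dx; rewrite -normc_gt0; apply: asymp_gt0 lead_asymp1 Dx _.
apply: (@eq_asymp _ _ _ _
    (fun x => normc (b2 x ord_max) ^+ (h * 2) * normc (c x) ^+ (2 * d)) _
    (fun x => 1 ^+ (h * 2) * normc (c x) ^+ (2 * d))) => [x Dx|x _|].
- rewrite ipevalE ?lead_neq0 // Normc.normcM exprMn normcX -exprM; congr (_ * _).
  rewrite rmorphXn /= normcX -exprM mulnC; congr (normc _ ^+ _).
  by rewrite /c bieval_e; apply: eq_bieval => j; exact: roots_a.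
- by rewrite expr1n mul1r.
- apply: asympM; first exact: asympX.
  by apply: asymp_refl => x _; rewrite exprn_ge0 ?normc_ge0.
Qed.

Lemma sym_abs_sum_asymp (s : seq (bipoly m n)) :
  exists (ps : seq (intpoly (m + n.+1))) (h : nat), (0 < h)%N /\
    asymp D (fun x => \sum_(p <- ps) normc (ipeval p (bcat (b1 x) (b2 x))) ^+ 2)
      (fun x => sym_abs_sum s (b1 x) (a x) ^+ (2 * h)).
Proof.
pose K := (#|{: 'S_n}| * size s)%N.
have [p p_asymp] :=
  choice (fun k : 'I_K => symmetrized_coef_asymp s k (K`! %/ (K - k))).
exists [seq p k | k <- enum 'I_K], K`!; split; first exact: fact_gt0.
pose values x := [seq bieval (b1 x) (a x \o (t : 'S_n)) e
  | t : 'S_n <- index_enum {: 'S_n}, e : bipoly m n <- s].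
have size_values x : D x -> size (values x) = K.
  by rewrite size_allpairs -[index_enum _]enumT -cardE.
apply: eq_asymp (asymp_trans (asymp_sum (index_enum 'I_K) p_asymp)
  (eq_asymp _ _ (asymp_comp size_values (sum_normc_asymp R K)))) => x _ //=.
- by rewrite big_map big_enum.
- by rewrite /coef_power_sum big_allpairs_dep.
- by rewrite big_allpairs_dep.
Qed.

End SymmetrizedFamilies.

(** * Planar Lebesgue measure *)

Section PlanarMeasure.
Local Open Scope classical_set_scope.
Variable R : realType.
Notation mu := (@lebC R).
Implicit Types (p q : {poly R[i]}) (w : R[i]) (z : R * R).

Definition box (x y u v : R) : set (R * R) := `[x, x + u] `*` `[y, y + v].

Definition csquare w (r : R) : set (R * R) :=
  box (complex.Re w - r) (complex.Im w - r) (2 * r) (2 * r).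

Lemma boxP (x y u v : R) z :
  box x y u v z <-> [/\ x <= z.1, z.1 <= x + u, y <= z.2 & z.2 <= y + v].
Proof.
rewrite /box /= !in_itv /=.
by split => [[/andP[-> ->] /andP[-> ->]]|[-> -> -> ->]].
Qed.

Lemma measurable_box (x y u v : R) : measurable (box x y u v).
Proof. by apply: measurableX; exact: measurable_itv. Qed.

Lemma lebC_box (x y u v : R) : 0 <= u -> 0 <= v -> mu (box x y u v) = (u * v)%:E.
Proof.
have len (c l : R) : 0 <= l ->
    (if c < c + l then ((c + l)%:E - c%:E)%E else 0%E) = l%:E.
  move=> l0; case: ltP => [_|le_c]; first by rewrite -EFinB addrC addKr.
  by congr EFin; apply/eqP; rewrite eq_le l0 /= -(lerD2l c) addr0.
move=> u0 v0; rewrite /lebC /box product_measure1E; try exact: measurable_itv.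
by rewrite /= !lebesgue_measure_itv /= !lte_fin !len.
Qed.

Lemma mem_csquare w r z : normc (cplx z - w) <= r -> csquare w r z.
Proof.
have := le_norm_Re (cplx z - w); have := le_norm_Im (cplx z - w).
case: z => u v; case: w => x y /= /ler_normlP[le_v ge_v] /ler_normlP[le_u ge_u] le_r.
by apply/boxP; split => /=; lra.
Qed.

Lemma unit_diskP z : @unit_disk R z <-> normc (cplx z) < 1.
Proof.
case: z => u v; rewrite /unit_disk /=.
by rewrite -[X in _ <-> is_true (_ < X)]sqrtr1 ltr_sqrt.
Qed.

Lemma measurable_Re_Im_horner p :
  measurable_fun setT (fun z : R * R => complex.Re p.[cplx z]) /\
  measurable_fun setT (fun z : R * R => complex.Im p.[cplx z]).
Proof.
elim/poly_ind: p => [|p c [mRe mIm]].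
  by split; under eq_fun do rewrite horner0; exact: measurable_cst.
have hornerE z : (p * 'X + c%:P).[cplx z] =
   Complex (complex.Re p.[cplx z] * z.1 - complex.Im p.[cplx z] * z.2 + complex.Re c)
     (complex.Re p.[cplx z] * z.2 + complex.Im p.[cplx z] * z.1 + complex.Im c).
  by rewrite hornerMXaddC; case: (p.[_]) => a b; case: c => x y; rewrite /cplx.
split; under eq_fun do rewrite hornerE /=.
  apply: measurable_funD; last exact: measurable_cst.
  by apply: measurable_funB; apply: measurable_funM.
apply: measurable_funD; last exact: measurable_cst.
by apply: measurable_funD; apply: measurable_funM.
Qed.

Lemma measurable_normc_horner p : measurable_fun setT (fun z => normc p.[cplx z]).
Proof.
have [mRe mIm] := measurable_Re_Im_horner p.
have -> : (fun z => normc p.[cplx z]) = (fun x : R => x `^ 2^-1) \o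
   (fun z => complex.Re p.[cplx z] ^+ 2 + complex.Im p.[cplx z] ^+ 2).
  apply/funext => z /=; rewrite powR12_sqrt ?addr_ge0 ?sqr_ge0 //.
  by case: (p.[_]).
apply: measurableT_comp; first exact: measurable_powR.
by apply: measurable_funD; apply: measurable_funX.
Qed.

Lemma measurable_unit_disk : measurable (@unit_disk R).
Proof.
have -> : @unit_disk R = setT `&` (fun z => normc 'X.[cplx z]) @^-1` `]-oo, 1[.
  rewrite setTI; apply/seteqP; split => z.
    by move/unit_diskP; rewrite /preimage /= hornerX in_itv.
  by rewrite /preimage /= hornerX in_itv => /unit_diskP.
exact: measurable_normc_horner.
Qed.

Definition zero_set q : set (R * R) := [set z | q.[cplx z] = 0].

Lemma measurable_zero_set q : measurable (zero_set q).
Proof.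
have -> : zero_set q = setT `&` (fun z => normc q.[cplx z]) @^-1` [set 0].
  rewrite setTI; apply/seteqP; split => z /=; last by move/Normc.eq0_normc.
  by move=> ->; exact: Normc.normc0.
exact: measurable_normc_horner.
Qed.

Lemma lebC_zero_set q : q != 0 -> mu (zero_set q) = 0%E.
Proof.
move=> q0; have [r qE] := closed_field_poly_normal q.
pose U := \big[setU/set0]_(w <- r) csquare w 0.
have [mU U0] : measurable U /\ mu U = 0%E.
  rewrite /U; elim/big_ind: _ => [|A B [mA A0] [mB B0]|w _].
  - by split; [exact: measurable0|exact: measure0].
  - by split; [exact: measurableU|rewrite -A0; exact: measureU0].
  - by split; [exact: measurable_box|rewrite /csquare lebC_box ?mulr0].
have zero_U : zero_set q `<=` U.
  move=> z /rootP; rewrite qE rootZ ?lead_coef_eq0 // root_prod_XsubC => zr.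
  rewrite /U (big_rem _ zr) /=; left; apply: mem_csquare.
  by rewrite subrr Normc.normc0.
apply/eqP; rewrite eq_le measure_ge0 andbT -U0.
by apply: le_measure => //; rewrite inE //; exact: measurable_zero_set.
Qed.

Lemma ae_horner_neq0 q : q != 0 -> \forall z \ae mu, q.[cplx z] != 0.
Proof.
move=> q0; exists (zero_set q); split; first exact: measurable_zero_set.
  exact: lebC_zero_set.
by move=> z /= /negP; rewrite negbK => /eqP.
Qed.

End PlanarMeasure.

Section NonnegativeIntegrals.
Local Open Scope classical_set_scope.
Local Open Scope ereal_scope.
Variables (d : measure_display) (T : measurableType d) (R : realType).
Variable mu : {measure set T -> \bar R}.
Variables (D : set T) (f : T -> \bar R).
Hypotheses (mD : measurable D) (mf : measurable_fun D f).
Hypothesis f0 : forall x, D x -> 0 <= f x.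

Lemma ge0_integral_cst_le (E : set T) (c : R) :
  measurable E -> E `<=` D -> (0 <= c)%R ->
  (\forall x \ae mu, E x -> c%:E <= f x) -> c%:E * mu E <= \int[mu]_(x in D) f x.
Proof.
move=> mE ED c0 le_cf; apply: (@le_trans _ _ (\int[mu]_(x in E) f x)).
  rewrite -integral_cst //; apply: ae_ge0_le_integral => //.
  - by move=> x /ED /f0.
  - exact: measurable_funS mf.
exact: ge0_subset_integral.
Qed.

Lemma ge0_integral_le_sum (J : finType) (H : J -> T -> \bar R) (c : J -> R) :
  (forall j, measurable_fun D (H j)) -> (forall j x, 0 <= H j x) ->
  (\forall x \ae mu, D x -> exists j, f x <= H j x) ->
  (forall j, \int[mu]_(x in D) H j x <= (c j)%:E) ->
  \int[mu]_(x in D) f x <= (\sum_j c j)%:E.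
Proof.
move=> mH H0 le_fH le_Hc.
apply: (@le_trans _ _ (\int[mu]_(x in D) \sum_j H j x)); last first.
  by rewrite ge0_integral_sum // -sumEFin; exact: lee_sum.
apply: ae_ge0_le_integral => //.
- by move=> x _; exact: sume_ge0.
- exact: emeasurable_sum.
apply: filterS le_fH => x /[apply] -[j le_j]; apply: le_trans le_j _.
by rewrite (bigD1 j) //= leeDl // sume_ge0.
Qed.

End NonnegativeIntegrals.

(** * Majorants of radial powers by dyadic squares *)

Section DyadicMajorant.
Local Open Scope classical_set_scope.
Variable R : realType.
Notation mu := (@lebC R).
Implicit Types (x s sg : R) (w : R[i]) (z : R * R).

Lemma dyadic_floor x : 1 <= x -> exists n, 2 ^+ n <= x < 2 ^+ n.+1.
Proof.
move=> x1; have ex : exists n, x < 2 ^+ n.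
  by exists (Num.bound x); exact: upper_nthrootP.
have [[|n] lt_x min_n] := ex_minnP ex; first by rewrite ltNge expr0 x1 in lt_x.
by exists n; rewrite lt_x andbT leNgt; apply/negP => /min_n; rewrite ltnn.
Qed.

Lemma le_powR_doubling x y sg : 0 < x -> x <= y <= 2 * x ->
  x `^ sg <= 2 `^ `|sg| * y `^ sg.
Proof.
move=> x0 /andP[le_xy le_y2x]; have y0 : 0 < y by exact: lt_le_trans le_xy.
have [sg0|sg0] := leP 0 sg.
  apply: (@le_trans _ _ (y `^ sg)).
    by rewrite ge0_ler_powR // nnegrE ltW.
  by rewrite ler_peMl ?powR_ge0 // -[leLHS](powRr0 2) ler_powR // ler1n.
rewrite -oppr_gt0 in sg0; rewrite -normrN gtr0_norm //.
rewrite -[in x `^ _](opprK sg) -[in y `^ _](opprK sg); move: (- sg) sg0 => u u0.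
rewrite !powRN ler_pdivlMr ?powR_gt0 // mulrC ler_pdivrMr ?powR_gt0 //.
rewrite -powRM ?(ltW x0) // ge0_ler_powR ?(ltW u0) //.
  by rewrite nnegrE ltW.
by rewrite nnegrE mulr_ge0 // ltW.
Qed.

(* The radial power [r `^ sg] is integrable near [0] if [-2 < sg] and near
   infinity if [sg < -2]; the dyadic scales accumulate accordingly. *)
Definition dyadic_ratio sg : R := if -2 < sg then 2^-1 else 2.

Definition integrable_side sg x : bool := if -2 < sg then x <= 1 else 1 <= x.

Lemma dyadic_ratio_gt0 sg : 0 < dyadic_ratio sg.
Proof. by rewrite /dyadic_ratio; case: ifP; rewrite ?invr_gt0. Qed.

Lemma dyadic_ratio_powR_lt1 sg : sg + 2 != 0 -> dyadic_ratio sg `^ (sg + 2) < 1.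
Proof.
move=> sg2; have one_powR (x : R) : 1 `^ x = 1 by rewrite powR1.
rewrite /dyadic_ratio; case: (ltP (-2) sg) => cmp_sg.
  rewrite -[ltRHS](one_powR (sg + 2)) gt0_ltr_powR ?nnegrE //; lra.
have lt0 : sg + 2 < 0 by rewrite lt_neqAle sg2 /=; lra.
rewrite -[sg + 2]opprK powRN invf_lt1 ?powR_gt0 //.
rewrite -[ltLHS](one_powR (- (sg + 2))) gt0_ltr_powR ?nnegrE //; lra.
Qed.

Lemma dyadic_ratio_cover sg x : 0 < x -> integrable_side sg x ->
  exists n, x <= dyadic_ratio sg ^+ n <= 2 * x.
Proof.
move=> x0; rewrite /integrable_side /dyadic_ratio; case: ifP => _ side.
  have [|n /andP[le_n lt_n]] := @dyadic_floor x^-1; first by rewrite invf_ge1.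
  have n0 : 0 < 2 ^+ n :> R by rewrite exprn_gt0.
  exists n; rewrite exprVn -[X in X <= _]invrK lef_pV2 ?posrE ?invr_gt0 // le_n /=.
  move: lt_n; rewrite exprS -(ltr_pM2r x0) mulVf ?gt_eqF // mulrAC => lt_n.
  by rewrite -[leLHS]mul1r ler_pdivrMr // ltW.
have [n /andP[le_n lt_n]] := dyadic_floor side.
by exists n.+1; rewrite (ltW lt_n) exprS ler_pM2l.
Qed.

Local Open Scope ereal_scope.

Definition majorant_term sg w s n z : \bar R :=
  ((2 `^ `|sg| * (dyadic_ratio sg ^+ n) `^ sg)%R)%:E *
  (\1_(csquare w (dyadic_ratio sg ^+ n * s)%R) z)%:E.

Definition majorant sg w s z : \bar R := \sum_(n <oo) majorant_term sg w s n z.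

Lemma majorant_term_ge0 sg w s n z : 0 <= majorant_term sg w s n z.
Proof. by rewrite /majorant_term -EFinM lee_fin !mulr_ge0 ?powR_ge0. Qed.

Lemma majorant_ge0 sg w s z : 0 <= majorant sg w s z.
Proof. by apply: nneseries_ge0 => n _ _; exact: majorant_term_ge0. Qed.

Lemma measurable_majorant_term sg w s n D :
  measurable_fun D (majorant_term sg w s n).
Proof.
apply: measurable_funeM; apply/measurable_EFinP; apply: measurable_indic.
exact: measurable_box.
Qed.

Lemma measurable_majorant sg w s D :
  measurable D -> measurable_fun D (majorant sg w s).
Proof.
move=> mD; apply: ge0_emeasurable_sum => [n z _ _|n _].
  exact: majorant_term_ge0.
exact: measurable_majorant_term.
Qed.

Lemma powR_le_majorant sg w s z (r := normc (cplx z - w)%R) :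
  (0 < s)%R -> (0 < r)%R -> integrable_side sg (r / s)%R ->
  (((r / s) `^ sg)%R)%:E <= majorant sg w s z.
Proof.
move=> s0 r0 side; have [|n /andP[le_n ge_n]] := dyadic_ratio_cover _ side.
  exact: divr_gt0.
have z_in : csquare w (dyadic_ratio sg ^+ n * s)%R z.
  by apply: mem_csquare; rewrite -ler_pdivrMr.
apply: (@le_trans _ _ (majorant_term sg w s n z)).
  rewrite /majorant_term indicE mem_set // mule1 lee_fin.
  by apply: le_powR_doubling; rewrite ?le_n ?divr_gt0.
apply: le_trans (nneseries_lim_ge n.+1 (P := xpredT) (m := 0%N) _) => [|k _ _].
  rewrite big_nat_recr //= leeDr //.
  by apply: sume_ge0 => k _; exact: majorant_term_ge0.
exact: majorant_term_ge0.
Qed.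

Definition majorant_mass sg : R :=
  (2 `^ `|sg| * 4 / (1 - dyadic_ratio sg `^ (sg + 2)))%R.

Lemma majorant_mass_ge0 sg : (sg + 2 != 0)%R -> (0 <= majorant_mass sg)%R.
Proof.
move=> sg2; rewrite divr_ge0 ?mulr_ge0 ?powR_ge0 // subr_ge0 ltW //.
exact: dyadic_ratio_powR_lt1.
Qed.

Lemma integral_majorant_term_le sg w s n D : measurable D -> (0 < s)%R ->
  \int[mu]_(z in D) majorant_term sg w s n z <=
  ((2 `^ `|sg| * 4 * s ^+ 2 * (dyadic_ratio sg `^ (sg + 2)) ^+ n)%R)%:E.
Proof.
move=> mD s0; have := dyadic_ratio_gt0 sg.
rewrite /majorant_term; set th := dyadic_ratio sg => th0.
have msq : measurable (csquare w (th ^+ n * s)%R) by exact: measurable_box.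
rewrite ge0_integralZl_EFin ?mulr_ge0 ?powR_ge0 //; last first.
  by apply/measurable_EFinP; exact: measurable_indic.
rewrite integral_indic //.
apply: (@le_trans _ _ (((2 `^ `|sg| * (th ^+ n) `^ sg)%R)%:E *
                       mu (csquare w (th ^+ n * s)%R))).
  rewrite lee_wpmul2l ?lee_fin ?mulr_ge0 ?powR_ge0 //.
  by apply: le_measure; rewrite ?inE //; exact: measurableI.
have side0 : (0 <= 2 * (th ^+ n * s))%R by rewrite !mulr_ge0 ?exprn_ge0 // ltW.
rewrite lebC_box // -EFinM lee_fin le_eqVlt; apply/orP; left; apply/eqP.
have -> : ((th `^ (sg + 2)) ^+ n = (th ^+ n) `^ sg * th ^+ n ^+ 2)%R.
  rewrite -!powR_mulrn ?powR_ge0 ?(ltW th0) // -!powRrM -powRD; last first.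
    by rewrite implybE (gt_eqF th0) orbT.
  by congr (_ `^ _)%R; ring.
by ring.
Qed.

Lemma nneseries_geometric_le (a q : R) : (0 <= a)%R -> (0 < q < 1)%R ->
  \sum_(n <oo) (a * q ^+ n)%:E <= (a / (1 - q))%:E.
Proof.
move=> a0 /andP[q0 q1]; apply: lime_le.
  by apply: is_cvg_nneseries => n _ _; rewrite lee_fin mulr_ge0 // exprn_ge0 // ltW.
apply: nearW => n; rewrite sumEFin lee_fin.
by have := @geometric_le_lim R n a q a0 q0; rewrite gtr0_norm //; apply.
Qed.

Lemma integral_majorant_le sg w s D : measurable D -> (0 < s)%R -> (sg + 2 != 0)%R ->
  \int[mu]_(z in D) majorant sg w s z <= ((majorant_mass sg * s ^+ 2)%R)%:E.
Proof.
move=> mD s0 sg2; rewrite integral_nneseries //; last 2 first.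
- by move=> n; exact: measurable_majorant_term.
- by move=> n z _; exact: majorant_term_ge0.
rewrite /majorant_mass mulrAC.
apply: le_trans (nneseries_geometric_le _ _); last 2 first.
- by rewrite mulr_ge0 ?sqr_ge0 // mulr_ge0 ?powR_ge0.
- by rewrite powR_gt0 ?dyadic_ratio_gt0 // dyadic_ratio_powR_lt1.
apply: lee_nneseries => [n _ _|n _]; last exact: integral_majorant_term_le.
by apply: integral_ge0 => z _; exact: majorant_term_ge0.
Qed.

End DyadicMajorant.

(** * Polynomials bounded below on a cell *)

Section LargeOnCell.
Variable R : realType.
Implicit Types (f : {poly R[i]}) (m g : R) (w : R * R).

Lemma interpolation_bound g n : 0 < g -> exists2 c : R, 0 < c &
  forall f (u : 'I_n -> R[i]) m, 0 <= m -> (size f <= n)%N ->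
    (forall i, normc (u i) <= 1) ->
    (forall i j, i != j -> g <= normc (u i - u j)) ->
    (forall i, normc f.[u i] <= m) -> tnorm f <= c * m.
Proof.
move=> g0; elim: n => [|n [c c0 IH]].
  exists 1 => // f u m m0; rewrite leqn0 size_poly_eq0 => /eqP -> _ _ _.
  by rewrite tnormC Normc.normc0 mul1r.
exists (2 * (c * (2 / g)) + 1); first by rewrite addr_gt0 // !mulr_gt0 // invr_gt0.
move=> f u m m0 size_f u1 u_sep fu_m; set w := u ord0.
pose q := f %/ ('X - w%:P).
have fE : f = q * ('X - w%:P) + f.[w]%:P by rewrite -modp_XsubC -divp_eq.
have size_q : (size q <= n)%N.
  by rewrite size_divp ?polyXsubC_eq0 // size_XsubC leq_subLR.
have le_q (i : 'I_n) : normc q.[u (lift ord0 i)] <= 2 / g * m.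
  have := u_sep _ _ (neq_lift ord0 i); rewrite normc_distC; set v := u _ => sep_vw.
  have qE : q.[v] * (v - w) = f.[v] - f.[w] by rewrite {1}fE !hornerE addrK.
  rewrite mulrAC ler_pdivlMr //.
  apply: (@le_trans _ _ (normc q.[v] * normc (v - w))).
    by rewrite ler_wpM2l ?normc_ge0.
  rewrite -Normc.normcM qE mulr_natl mulr2n.
  by apply: le_trans (le_normcB _ _) _; rewrite lerD ?fu_m.
have le_tq : tnorm q <= c * (2 / g * m).
  apply: (IH q (fun i => u (lift ord0 i))) => //.
  - by rewrite !mulr_ge0 // invr_ge0 ltW.
  - by move=> i j ij; apply: u_sep; rewrite (inj_eq lift_inj).
have -> : (2 * (c * (2 / g)) + 1) * m = 2 * (c * (2 / g * m)) + m by ring.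
rewrite fE; apply: le_trans (le_tnormD _ _) _.
rewrite lerD ?tnormC ?fu_m //; apply: le_trans (le_tnorm_mulXsubC _ _) _.
by rewrite ler_pM ?addr_ge0 ?normc_ge0 ?tnorm_ge0 // -[leRHS]/(1 + 1) lerD2l u1.
Qed.

Definition cell_size (M : nat) : R := (8 * M.+1%:R)^-1.

Definition cell M (l : 'I_M.+1) : set (R * R) :=
  box (2 * l%:R * cell_size M) 0 (cell_size M) (cell_size M).

Lemma cell_size_gt0 M : 0 < cell_size M.
Proof. by rewrite invr_gt0 mulr_gt0. Qed.

Lemma normc_cell M (l : 'I_M.+1) w : cell l w -> normc (cplx w) <= 1 / 4.
Proof.
have := cell_size_gt0 M; rewrite /cell; set h := cell_size M => h0.
move=> /boxP[le_u ge_u v0 le_v]; apply: le_trans (le_normc_Re_Im _) _.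
have u0 : 0 <= w.1 by apply: le_trans le_u; rewrite !mulr_ge0 // ltW.
rewrite /= !ger0_norm //; apply: (@le_trans _ _ (2 * (l%:R + 1) * h)); first lra.
have hE : 8 * M.+1%:R * h = 1 by rewrite mulfV // gt_eqF // mulr_gt0.
have : (l%:R + 1) * h <= M.+1%:R * h by rewrite ler_pM2r // natr1 ler_nat.
lra.
Qed.

Lemma cell_separated M (l l' : 'I_M.+1) w w' : cell l w -> cell l' w' -> l != l' ->
  cell_size M <= normc (cplx w - cplx w').
Proof.
have := cell_size_gt0 M; rewrite /cell; set h := cell_size M => h0.
wlog lt_l : l l' w w' / (l < l')%N.
  move=> lt_case wl wl' ne; have [lt_l|lt_l|/val_inj eq_l] := ltngtP l l'.
  - exact: (lt_case l l').
  - by rewrite normc_distC; apply: (lt_case l' l); rewrite // eq_sym.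
  - by rewrite eq_l eqxx in ne.
move=> /boxP[_ ge_w _ _] /boxP[le_w' _ _ _] _.
have le_l : (l%:R + 1) * h <= l'%:R * h by rewrite ler_pM2r // natr1 ler_nat.
apply: le_trans (le_norm_Re _); rewrite /= distrC ler_normr.
by apply/orP; left; lra.
Qed.

(* A polynomial of degree at most [M] cannot be small at a point of each of the
   [M + 1] cells. *)
Lemma large_on_cell M : exists2 c : R, 0 < c & forall f, (size f <= M.+1)%N ->
  exists l : 'I_M.+1, forall w, cell l w -> c * tnorm f <= normc f.[cplx w].
Proof.
have [c c0 le_c] := interpolation_bound M.+1 (cell_size_gt0 M).
exists (2 * c)^-1 => [|f size_f]; first by rewrite invr_gt0 mulr_gt0.
apply: contrapT => /forallNP small.
have small_point (l : 'I_M.+1) :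
    exists w, cell l w /\ normc f.[cplx w] < (2 * c)^-1 * tnorm f.
  have /existsNP[w /not_implyP[wl /negP]] := small l.
  by rewrite -ltNge; exists w.
have [u u_small] := choice small_point.
have tf0 : 0 <= (2 * c)^-1 * tnorm f.
  by rewrite mulr_ge0 ?tnorm_ge0 // invr_ge0 mulr_ge0 // ltW.
have : tnorm f <= c * ((2 * c)^-1 * tnorm f).
  apply: (le_c f (fun l => cplx (u l))) => // [i|i j ij|i].
  - by apply: le_trans (normc_cell (u_small i).1) _; lra.
  - exact: cell_separated (u_small i).1 (u_small j).1 ij.
  - exact: ltW (u_small i).2.
have -> : c * ((2 * c)^-1 * tnorm f) = tnorm f / 2 by field; rewrite gt_eqF.
move=> le_half; have := le_lt_trans (normc_ge0 _) (u_small ord0).2.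
have -> : tnorm f = 0 by have := tnorm_ge0 f; lra.
by rewrite mulr0 ltxx.
Qed.

End LargeOnCell.

(** * Local weights at the scales of the roots *)

Lemma ler_powR_div (R : realType) (eps dl a b p q C : R) :
  0 <= eps -> 0 <= dl -> 0 <= a -> a <= b -> 0 <= C -> 0 < p -> p <= C * q ->
  a `^ eps / q `^ dl <= C `^ dl * (b `^ eps / p `^ dl).
Proof.
move=> eps0 dl0 a0 ab C0 p0 pq; have Cq0 : 0 < C * q by exact: lt_le_trans pq.
have q0 : 0 < q.
  by rewrite ltNge; apply: contraTN Cq0 => q_le0; rewrite -leNgt mulr_ge0_le0.
rewrite mulrCA ler_pM ?invr_ge0 ?powR_ge0 //.
  by rewrite ge0_ler_powR // nnegrE (le_trans a0).
rewrite ler_pdivlMr ?powR_gt0 // mulrC ler_pdivrMr ?powR_gt0 // -powRM ?(ltW q0) //.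
by rewrite ge0_ler_powR ?nnegrE ?(ltW p0) ?(ltW Cq0).
Qed.

Record pole_config (R : realType) (N : nat) := PoleConfig {
  numer : {poly R[i]};
  denom : {poly R[i]};
  pole : 'I_N -> R[i]
}.

Section Configurations.
Local Open Scope classical_set_scope.
Variables (R : realType) (M N : nat) (eps dl : R).
Notation mu := (@lebC R).
Implicit Types (x : pole_config R N) (z : R * R) (r s : R).

Record admissible x : Prop := Admissible {
  numer_neq0 : numer x != 0;
  size_numer : (size (numer x) <= M.+1)%N;
  denomE : denom x = lead_coef (denom x) *: \prod_(i < N) ('X - (pole x i)%:P);
  normc_lead_denom : 1 / 2 <= normc (lead_coef (denom x)) <= 2;
  normc_pole : forall i, normc (pole x i) <= 1 / 4;
  pole_inj : injective (pole x)
}.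

Definition integrand x z : R :=
  normc (numer x).[cplx z] `^ eps / normc (denom x).[cplx z] `^ dl.

Definition disk_integral x : \bar R :=
  (\int[mu]_(z in @unit_disk R) (integrand x z)%:E)%E.

Definition taylor_coef x i (nu : 'I_M.+1) : R := normc (numer x)^`N(nu).[pole x i].

Definition monomial_sum (F : 'I_M.+1 -> R) r : R := \sum_nu F nu * r ^+ nu.

Definition pole_dist x i j : R := normc (pole x i - pole x j).

Definition pole_product x i r : R := \prod_(j < N) (r + pole_dist x i j).

Definition local_weight x i r : R :=
  monomial_sum (taylor_coef x i) r `^ eps / pole_product x i r `^ dl.

(* [2] is a radius such that every disk of that radius centred at a pole covers
   the unit disk. *)
Definition dist_scale (J : eqType) (d : J -> R) (i l : J) : R :=
  if l == i then 2 else d l.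

Definition pole_scale x i l : R := dist_scale (pole_dist x i) i l.

Definition scale_term x (j : 'I_N * 'I_N) : R :=
  let s := pole_scale x j.1 j.2 in local_weight x j.1 s * s ^+ 2.

Lemma integrand_ge0 x z : 0 <= integrand x z.
Proof. by rewrite divr_ge0 ?powR_ge0. Qed.

Lemma measurable_integrand x D : measurable_fun D (fun z => (integrand x z)%:E).
Proof.
apply: measurable_funTS; apply/measurable_EFinP; rewrite /integrand.
under eq_fun do rewrite -powRN.
apply: measurable_funM; apply: (measurableT_comp (measurable_powR _));
  exact: measurable_normc_horner.
Qed.

Lemma disk_integral_ge0 x : (0 <= disk_integral x)%E.
Proof. by apply: integral_ge0 => z _; rewrite lee_fin integrand_ge0. Qed.

Lemma monomial_sum_ge0 (F : 'I_M.+1 -> R) r :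
  (forall nu, 0 <= F nu) -> 0 <= r -> 0 <= monomial_sum F r.
Proof. by move=> F0 r0; apply: sumr_ge0 => nu _; rewrite mulr_ge0 ?exprn_ge0. Qed.

Lemma taylor_coef_ge0 x i nu : 0 <= taylor_coef x i nu.
Proof. exact: normc_ge0. Qed.

Lemma pole_dist_ge0 x i j : 0 <= pole_dist x i j.
Proof. exact: normc_ge0. Qed.

Lemma pole_dist_diag x i : pole_dist x i i = 0.
Proof. by rewrite /pole_dist subrr Normc.normc0. Qed.

Lemma pole_dist_gt0 x i j : admissible x -> j != i -> 0 < pole_dist x i j.
Proof.
by move=> adm ji; rewrite normc_gt0 subr_eq0 (inj_eq (pole_inj adm)) eq_sym.
Qed.

Lemma dist_scale_gt0 (J : eqType) (d : J -> R) i l :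
  (forall j, j != i -> 0 < d j) -> 0 < dist_scale d i l.
Proof. by move=> d_gt0; rewrite /dist_scale; case: eqP => [//|/eqP /d_gt0]. Qed.

Lemma pole_scale_gt0 x i l : admissible x -> 0 < pole_scale x i l.
Proof. by move=> adm; apply: dist_scale_gt0 => j; exact: pole_dist_gt0. Qed.

Lemma pole_scale_le2 x i l : admissible x -> pole_scale x i l <= 2.
Proof.
move=> adm; rewrite /pole_scale /dist_scale; case: eqP => // _.
apply: le_trans (le_normcB _ _) _.
by have := normc_pole adm i; have := normc_pole adm l; lra.
Qed.

Lemma pole_product_gt0 x i r : 0 < r -> 0 < pole_product x i r.
Proof. by move=> r0; apply: prodr_gt0 => j _; rewrite ltr_pwDl ?pole_dist_ge0. Qed.

Lemma local_weight_ge0 x i r : 0 <= local_weight x i r.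
Proof. by rewrite divr_ge0 ?powR_ge0. Qed.

Lemma scale_term_ge0 x j : 0 <= scale_term x j.
Proof. by rewrite mulr_ge0 ?local_weight_ge0 ?sqr_ge0. Qed.

Lemma lead_denom_neq0 x : admissible x -> lead_coef (denom x) != 0.
Proof. by move=> adm; rewrite -normc_gt0; have := normc_lead_denom adm; lra. Qed.

Lemma denom_neq0 x : admissible x -> denom x != 0.
Proof. by move=> adm; rewrite -lead_coef_eq0 lead_denom_neq0. Qed.

Lemma normc_denom x w : admissible x -> normc (denom x).[w] =
  normc (lead_coef (denom x)) * \prod_(j < N) normc (w - pole x j).
Proof.
move=> adm; rewrite {1}(denomE adm) hornerZ Normc.normcM horner_prod normc_prod.
by congr (_ * _); apply: eq_bigr => j _; rewrite !hornerE.
Qed.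

Lemma numer_taylor x i w : admissible x ->
  (numer x).[w] =
  \sum_(nu < M.+1) (numer x)^`N(nu).[pole x i] * (w - pole x i) ^+ nu.
Proof.
move=> adm; rewrite -(nderiv_taylor_wide (mulrC _ _) (size_numer adm)).
by rewrite addrC subrK.
Qed.

(** * The lower bound *)

Hypotheses (eps0 : 0 <= eps) (dl0 : 0 <= dl).

Definition scaled_cell x i s (k : 'I_M.+1) : set (R * R) :=
  box (complex.Re (pole x i) + s * (2 * k%:R * cell_size R M))
    (complex.Im (pole x i)) (s * cell_size R M) (s * cell_size R M).

Lemma scaled_cellP x i s k z : 0 < s -> scaled_cell x i s k z ->
  exists2 w, cell k w & cplx z = pole x i + (s%:C)%C * cplx w.
Proof.
move=> s0 /boxP[le_u ge_u le_v ge_v].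
exists ((z.1 - complex.Re (pole x i)) / s, (z.2 - complex.Im (pole x i)) / s).
  apply/boxP; split; rewrite /= ?ler_pdivlMr // ?ler_pdivrMr // ?lerBrDl ?lerBlDl.
  - by rewrite mulrC.
  - by rewrite mulrC mulrDr addrA.
  - by rewrite mul0r addr0.
  - by rewrite add0r mulrC.
case: z {le_u ge_u le_v ge_v} => u v; case: (pole x i) => a b.
apply/eqP; rewrite eq_complex /= !mul0r subr0 addr0.
have s_neq0 : s != 0 by rewrite gt_eqF.
by apply/andP; split; apply/eqP; field.
Qed.

Lemma scaled_cell_disk x i s k : admissible x -> 0 < s -> s <= 2 ->
  scaled_cell x i s k `<=` @unit_disk R.
Proof.
move=> adm s0 s2 z /(scaled_cellP s0)[w wk zE]; apply/unit_diskP; rewrite zE.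
apply: le_lt_trans (le_normcD _ _) _; rewrite Normc.normcM normc_real gtr0_norm //.
have := normc_pole adm i; have := normc_cell wk; have := normc_ge0 (cplx w).
by move: (normc (pole x i)) (normc (cplx w)) => a b; nra.
Qed.

(* At a zero of the denominator the integrand takes the junk value [0] if [dl != 0]. *)
Lemma local_weight_le_integrand : exists2 c : R, 0 < c &
  forall x i s, admissible x -> 0 < s -> exists k, forall z,
    scaled_cell x i s k z -> (denom x).[cplx z] != 0 ->
    c * local_weight x i s <= integrand x z.
Proof.
have [c c0 large] := large_on_cell R M.
exists (c `^ eps / 2 `^ dl) => [|x i s adm s0]; first by rewrite divr_gt0 ?powR_gt0.
pose f : {poly R[i]} :=
  \poly_(nu < M.+1) ((numer x)^`N(nu).[pole x i] * (s%:C)%C ^+ nu).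
have size_f : (size f <= M.+1)%N by exact: size_poly.
have tnorm_f : tnorm f = monomial_sum (taylor_coef x i) s.
  rewrite (tnorm_widen size_f); apply: eq_bigr => nu _.
  by rewrite coef_poly ltn_ord Normc.normcM normcX normc_real gtr0_norm.
have [k large_k] := large f size_f; exists k => z /(scaled_cellP s0)[w wk zE] qz.
have numerE : (numer x).[cplx z] = f.[cplx w].
  rewrite (numer_taylor i _ adm) horner_poly; apply: eq_bigr => nu _.
  by rewrite zE addrC addKr exprMn mulrA.
have sum_ge0 : 0 <= monomial_sum (taylor_coef x i) s by rewrite -tnorm_f tnorm_ge0.
rewrite /local_weight mulrACA -powRM ?(ltW c0) // mulrA mulrAC.
rewrite ler_pdivrMr ?powR_gt0 // [leRHS]mulrC.
apply: ler_powR_div; rewrite ?mulr_ge0 ?normc_gt0 ?(ltW c0) //.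
  by rewrite numerE -tnorm_f large_k.
rewrite normc_denom // ler_pM ?normc_ge0 //.
- by apply: prodr_ge0 => j _; exact: normc_ge0.
- by have /andP[] := normc_lead_denom adm.
apply: ler_prod => j _; rewrite normc_ge0 andTb zE addrAC addrC.
apply: le_trans (le_normcD _ _) _.
rewrite lerD2r Normc.normcM normc_real gtr0_norm //.
by rewrite ler_piMr ?(ltW s0) // (le_trans (normc_cell wk)) //; lra.
Qed.

Lemma disk_integral_ge_scale_term : exists2 c : R, 0 < c &
  forall x j, admissible x -> ((c * scale_term x j)%:E <= disk_integral x)%E.
Proof.
have [c c0 le_integrand] := local_weight_le_integrand.
have h0 := cell_size_gt0 R M.
exists (c * cell_size R M ^+ 2) => [|x [i l] adm].
  by rewrite mulr_gt0 ?exprn_gt0.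
have s0 := pole_scale_gt0 i l adm.
have [k le_k] := le_integrand x i _ adm s0; set s := pole_scale x i l in s0 le_k *.
have -> : (c * cell_size R M ^+ 2 * scale_term x (i, l))%:E =
    ((c * local_weight x i s)%:E * mu (scaled_cell x i s k))%E.
  rewrite /scaled_cell lebC_box ?mulr_ge0 ?ltW // -EFinM /scale_term -/s.
  by congr (_%:E); ring.
apply: ge0_integral_cst_le.
- exact: measurable_unit_disk.
- exact: measurable_integrand.
- by move=> z _; rewrite lee_fin integrand_ge0.
- exact: measurable_box.
- exact/scaled_cell_disk/pole_scale_le2.
- by rewrite mulr_ge0 ?local_weight_ge0 // ltW.
have ae_neq0 := ae_horner_neq0 (denom_neq0 adm).
apply: (@filterS _ _ (ae_filter_ringOfSetsType _)) ae_neq0.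
by move=> z qz zk; rewrite lee_fin le_k.
Qed.

End Configurations.

Arguments taylor_coef {R} M {N} x i nu.

(** * The upper bound *)

Section NearestScale.
Variables (R : realType) (J : finType) (d : J -> R) (i : J) (r : R).
Hypotheses (d0 : forall j, 0 <= d j) (di : d i = 0).
Hypotheses (d_gt0 : forall j, j != i -> 0 < d j) (r0 : 0 < r) (r2 : r <= 2).

Definition close_count : nat := #|[pred j | d j <= r]|.

Definition same_side (s : R) : Prop :=
  forall j, (d j <= r -> d j <= s) /\ (r < d j -> s <= d j).

Lemma close_count_gt0 : (0 < close_count)%N.
Proof. by apply/card_gt0P; exists i; rewrite inE di ltW. Qed.

Lemma close_count_le : (close_count <= #|J|)%N.
Proof. exact: max_card. Qed.

Lemma same_side_scale_above :
  exists l, r <= dist_scale d i l /\ same_side (dist_scale d i l).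
Proof.
have [j0 lt_j0|none] := pickP (fun j => r < d j); last first.
  exists i; rewrite /dist_scale eqxx; split => // j; split; last by rewrite none.
  by move=> le_j; exact: le_trans r2.
have [l lt_l min_l] := @arg_minP _ _ _ j0 (fun j => r < d j) d lt_j0.
have li : l != i by apply: contraTneq lt_l => ->; rewrite di -leNgt ltW.
exists l; rewrite /dist_scale (negPf li); split; first exact: ltW.
by move=> j; split => [le_j|/min_l //]; exact: le_trans le_j (ltW lt_l).
Qed.

Lemma same_side_scale_below : (1 < close_count)%N ->
  exists l, dist_scale d i l <= r /\ same_side (dist_scale d i l).
Proof.
move=> count1; pose near j := (d j <= r) && (j != i).
have [j0 near_j0|none] := pickP near; last first.
  suff : (close_count <= 1)%N by rewrite leqNgt count1.
  rewrite -(card1 i); apply/subset_leq_card/fintype.subsetP => j.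
  rewrite !inE => le_j.
  by have := none j; rewrite /near le_j => /negbFE.
have [l /andP[le_l li] max_l] := @arg_maxP _ _ _ j0 near d near_j0.
exists l; rewrite /dist_scale (negPf li); split => // j; split => [le_j|/ltW].
  have [->|ji] := eqVneq j i; first by rewrite di.
  by apply: max_l; rewrite /near le_j.
exact: le_trans le_l.
Qed.

Lemma nearest_scale sg : (sg <= -2 -> (1 < close_count)%N) ->
  exists l, integrable_side sg (r / dist_scale d i l) /\
            same_side (dist_scale d i l).
Proof.
move=> count1; rewrite /integrable_side; case: ltP => sg2.
  have [l [le_l side]] := same_side_scale_above; exists l; split => //.
  by rewrite ler_pdivrMr ?mul1r // dist_scale_gt0.
have [l [le_l side]] := same_side_scale_below (count1 sg2); exists l; split => //.
by rewrite ler_pdivlMr ?mul1r // dist_scale_gt0.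
Qed.

Lemma prod_max_rescale s : 0 < s -> same_side s ->
  \prod_j Num.max r (d j) = (r / s) ^+ close_count * \prod_j Num.max s (d j).
Proof.
move=> s0 side; rewrite -prodr_const [X in X * _]big_mkcond -big_split /=.
apply: eq_bigr => j _; have [le_s ge_s] := side j; rewrite inE.
case: (leP (d j) r) => dr; first by rewrite max_l ?le_s // divfK // gt_eqF.
by rewrite mul1r max_r ?ge_s.
Qed.

End NearestScale.

Section RadialBound.
Variables (R : realType) (M : nat) (J : finType) (eps dl : R).
Hypotheses (eps0 : 0 <= eps) (dl2 : dl < 2).
Implicit Types (F : 'I_M.+1 -> R) (d : J -> R) (r s : R).

Definition radial_exponent (nu k : nat) : R := nu%:R * eps - k%:R * dl.

Definition radial_weight F d r : R :=
  monomial_sum F r `^ eps / (\prod_j Num.max r (d j)) `^ dl.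

Lemma monomial_sum_rescale F r : (forall nu, 0 <= F nu) -> 0 < r ->
  exists nu : 'I_M.+1, forall s, 0 < s ->
    monomial_sum F r <= M.+1%:R * monomial_sum F s * (r / s) ^+ nu.
Proof.
move=> F0 r0.
have [nu _ max_nu] := @arg_maxP _ _ _ ord0 xpredT (fun nu => F nu * r ^+ nu) isT.
exists nu => s s0; apply: (@le_trans _ _ (M.+1%:R * (F nu * r ^+ nu))).
  rewrite mulr_natl -[X in _ *+ X](card_ord M.+1) -sumr_const.
  by apply: ler_sum => j _; exact: max_nu.
have -> : r ^+ nu = s ^+ nu * (r / s) ^+ nu by rewrite -exprMn mulrC divfK ?gt_eqF.
rewrite -mulrA ler_pM2l // mulrA.
rewrite ler_wpM2r ?exprn_ge0 ?divr_ge0 ?(ltW r0) ?(ltW s0) //.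
rewrite /monomial_sum (bigD1 nu) //= lerDl.
by apply: sumr_ge0 => j _; rewrite mulr_ge0 // exprn_ge0 // ltW.
Qed.

(* Between two consecutive scales the radial weight is a power of the radius up to a
   constant, hence controlled by its value at the endpoint on the integrable side. *)
Lemma radial_weight_le_at_scale F d i r :
  (forall nu, 0 <= F nu) -> (forall j, 0 <= d j) -> d i = 0 ->
  (forall j, j != i -> 0 < d j) -> 0 < r -> r <= 2 ->
  exists l (nu : 'I_M.+1) (k : 'I_#|J|), let s := dist_scale d i l in
    integrable_side (radial_exponent nu k.+1) (r / s) /\
    radial_weight F d r <=
      M.+1%:R `^ eps * radial_weight F d s * (r / s) `^ radial_exponent nu k.+1.
Proof.
move=> F0 d0 di d_gt0 r0 r2; have [nu le_nu] := monomial_sum_rescale F0 r0.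
have count0 := close_count_gt0 di r0.
have lt_k : ((close_count d r).-1 < #|J|)%N by rewrite prednK // close_count_le.
have [l [side same]] : exists l, let s := dist_scale d i l in
    integrable_side (radial_exponent nu (close_count d r)) (r / s) /\
    same_side d r s.
  (* If [i] is the only close index, then the exponent is at least [- dl > -2]. *)
  apply: nearest_scale => // le_sg; rewrite ltn_neqAle count0 andbT.
  apply: contraTneq le_sg => <-; rewrite -ltNge /radial_exponent mul1r.
  by apply: (@lt_le_trans _ _ (- dl)); rewrite ?ltrN2 // lerDr mulr_ge0.
exists l, nu, (Ordinal lt_k); rewrite /= prednK //; split => //.
have := dist_scale_gt0 l d_gt0; move: (dist_scale d i l) side same => s side same s0.
have x0 : 0 < r / s by rewrite divr_gt0.
have prod0 : 0 < \prod_j Num.max s (d j).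
  by apply: prodr_gt0 => j _; rewrite lt_max s0.
have sum0 t : 0 < t -> 0 <= monomial_sum F t by move=> /ltW; exact: monomial_sum_ge0.
rewrite /radial_weight (prod_max_rescale s0 same) /radial_exponent powRB; last first.
  by rewrite implybE (gt_eqF x0) orbT.
rewrite !powRrM !powR_mulrn ?(ltW x0) //.
rewrite powRM ?exprn_ge0 ?(ltW x0) ?(ltW prod0) //.
move: (ltW x0) (le_nu s s0); set x := r / s => x_ge0 le_r.
apply: (@le_trans _ _ ((M.+1%:R * monomial_sum F s * x ^+ nu) `^ eps /
    ((x ^+ close_count d r) `^ dl * (\prod_j Num.max s (d j)) `^ dl))).
  rewrite ler_wpM2r ?invr_ge0 ?mulr_ge0 ?powR_ge0 // ge0_ler_powR ?nnegrE ?sum0 //.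
  by rewrite !mulr_ge0 ?exprn_ge0 ?sum0.
rewrite !powRM ?mulr_ge0 ?exprn_ge0 ?sum0 // invfM.
by rewrite le_eqVlt; apply/orP; left; apply/eqP; ring.
Qed.

End RadialBound.

Section UpperBound.
Variables (R : realType) (M N : nat) (eps dl : R).
Hypotheses (eps0 : 0 <= eps) (dl0 : 0 <= dl) (dl2 : dl < 2) (N0 : (0 < N)%N).
Notation mu := (@lebC R).
Implicit Types (x : pole_config R N) (z : R * R).

Lemma normc_numer_le x i (w : R[i]) : admissible M x ->
  normc (numer x).[w] <= monomial_sum (taylor_coef M x i) (normc (w - pole x i)).
Proof.
move=> adm; rewrite (numer_taylor i _ adm); apply: le_trans (le_normc_sum _ _ _) _.
by apply: ler_sum => nu _; rewrite Normc.normcM normcX.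
Qed.

Lemma prod_max_le_denom x i (w : R[i]) : admissible M x ->
  (forall j, normc (w - pole x i) <= normc (w - pole x j)) ->
  \prod_j Num.max (normc (w - pole x i)) (pole_dist x i j) <=
    2 * 2 ^+ N * normc (denom x).[w].
Proof.
move=> adm nearest; rewrite (normc_denom _ adm).
set lc := normc (lead_coef _).
have -> : 2 * 2 ^+ N * (lc * \prod_(j < N) normc (w - pole x j)) =
    2 * lc * \prod_(j < N) (2 * normc (w - pole x j)).
  by rewrite big_split /= prodr_const card_ord; ring.
rewrite -[leLHS]mul1r ler_pM ?prodr_ge0 //.
- by move=> j _; rewrite le_max normc_ge0.
- by have /andP[] := normc_lead_denom adm; rewrite -/lc; lra.
apply: ler_prod => j _; rewrite le_max normc_ge0 /= ge_max mulr_natl mulr2n.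
rewrite (le_trans (nearest j)) ?lerDl ?normc_ge0 //=.
apply: le_trans (le_normc_dist w _ _) _.
by rewrite [normc (pole x i - w)]normc_distC lerD2r.
Qed.

Lemma integrand_le_radial_weight x i z (r := normc (cplx z - pole x i)) :
  admissible M x -> 0 < r ->
  (forall j, r <= normc (cplx z - pole x j)) ->
  integrand eps dl x z <= (2 * 2 ^+ N) `^ dl *
    radial_weight eps dl (taylor_coef M x i) (pole_dist x i) r.
Proof.
move=> adm r0 nearest.
apply: ler_powR_div; rewrite ?normc_ge0 ?mulr_ge0 ?exprn_ge0 //.
- exact: normc_numer_le.
- by apply: prodr_gt0 => j _; rewrite lt_max r0.
- exact: prod_max_le_denom.
Qed.

Lemma radial_weight_le_local_weight x i s : 0 < s ->
  radial_weight eps dl (taylor_coef M x i) (pole_dist x i) s <=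
    (2 ^+ N) `^ dl * local_weight M eps dl x i s.
Proof.
move=> s0; apply: ler_powR_div => //.
- by apply: monomial_sum_ge0; [exact: taylor_coef_ge0|exact: ltW].
- exact: pole_product_gt0.
rewrite -[X in _ ^+ X]card_ord -prodr_const -big_split /=.
apply: ler_prod => j _; rewrite addr_ge0 ?pole_dist_ge0 ?(ltW s0) //=.
by rewrite mulr_natl mulr2n lerD // le_max lexx ?orbT.
Qed.

Definition pointwise_const : R :=
  (2 * 2 ^+ N) `^ dl * (M.+1%:R `^ eps * (2 ^+ N) `^ dl).

Lemma integrand_le_scale_power x z : admissible M x -> @unit_disk R z ->
  (denom x).[cplx z] != 0 ->
  exists i l (nu : 'I_M.+1) (k : 'I_#|'I_N|),
    let r := normc (cplx z - pole x i) in let s := pole_scale x i l in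
    let sg := radial_exponent eps dl nu k.+1 in
    [/\ 0 < r, integrable_side sg (r / s) &
      integrand eps dl x z <=
        pointwise_const * local_weight M eps dl x i s * (r / s) `^ sg].
Proof.
move=> adm /unit_diskP z1 qz.
have [i _ nearest] := @arg_minP _ _ _ (Ordinal N0) xpredT
  (fun j => normc (cplx z - pole x j)) isT.
pose r := normc (cplx z - pole x i).
have r0 : 0 < r.
  rewrite normc_gt0; apply: contraNneq qz => zi; rewrite -normc_eq0.
  by rewrite (normc_denom _ adm) (bigD1 i) //= zi Normc.normc0 mul0r mulr0.
have r2 : r <= 2.
  by apply: le_trans (le_normcB _ _) _; have := normc_pole adm i; lra.
have [l [nu [k [side le_weight]]]] :=
  radial_weight_le_at_scale eps0 dl2 (@taylor_coef_ge0 _ M _ x i) (pole_dist_ge0 x i)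
    (pole_dist_diag x i) (fun j => pole_dist_gt0 adm) r0 r2.
exists i, l, nu, k; split => //=; rewrite -/(pole_scale x i l) in side le_weight.
apply: le_trans (integrand_le_radial_weight adm r0 (fun j => nearest j isT)) _.
rewrite -[leRHS]mulrA -[leRHS]mulrA ler_wpM2l ?powR_ge0 //.
apply: le_trans le_weight _; rewrite -[leLHS]mulrA -[leRHS]mulrA.
rewrite ler_wpM2l ?powR_ge0 // [leRHS]mulrA ler_wpM2r ?powR_ge0 //.
exact: radial_weight_le_local_weight (pole_scale_gt0 i l adm).
Qed.

Hypothesis nonresonant : forall nu k : nat, (nu <= M)%N -> (k < N)%N ->
  radial_exponent eps dl nu k.+1 + 2 != 0.

Lemma nonresonant_index (nu : 'I_M.+1) (k : 'I_#|'I_N|) :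
  radial_exponent eps dl nu k.+1 + 2 != 0.
Proof.
by apply: nonresonant; [rewrite -ltnS|rewrite -[X in (_ < X)%N]card_ord].
Qed.

Lemma disk_integral_le_mass_sum x (sg := fun y : 'I_M.+1 * 'I_#|'I_N| =>
    radial_exponent eps dl y.1 y.2.+1) : admissible M x ->
  (disk_integral eps dl x <=
   (\sum_(jy : ('I_N * 'I_N) * ('I_M.+1 * 'I_#|'I_N|))
      pointwise_const * majorant_mass (sg jy.2) * scale_term M eps dl x jy.1)%:E)%E.
Proof.
move=> adm; pose s (j : 'I_N * 'I_N) := pole_scale x j.1 j.2.
pose weight j := pointwise_const * local_weight M eps dl x j.1 (s j).
have weight0 j : 0 <= weight j.
  by rewrite mulr_ge0 ?local_weight_ge0 // !mulr_ge0 ?powR_ge0.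
pose H (jy : ('I_N * 'I_N) * ('I_M.+1 * 'I_#|'I_N|)) z : \bar R :=
  ((weight jy.1)%:E * majorant (sg jy.2) (pole x jy.1.1) (s jy.1) z)%E.
have mdisk := @measurable_unit_disk R.
apply: (@ge0_integral_le_sum _ _ R mu _ _ _ _ _ _ H) => // [|z _|jy|jy z||[j y]].
- exact: measurable_integrand.
- by rewrite lee_fin integrand_ge0.
- by apply: measurable_funeM; exact: measurable_majorant.
- by rewrite mule_ge0 ?majorant_ge0 // lee_fin.
- have ae_neq0 := ae_horner_neq0 (denom_neq0 adm).
  apply: (@filterS _ _ (ae_filter_ringOfSetsType _)) ae_neq0.
  move=> z qz zB.
  have [i [l [nu [k [r0 side le_z]]]]] := integrand_le_scale_power adm zB qz.
  exists ((i, l), (nu, k)); rewrite /H /=.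
  have := powR_le_majorant (pole_scale_gt0 i l adm) r0 side.
  move=> /(lee_wpmul2l (weight0 (i, l) : (0 <= (weight (i, l))%:E)%E)).
  by apply: le_trans; rewrite -EFinM lee_fin.
have -> : pointwise_const * majorant_mass (sg y) * scale_term M eps dl x j =
    weight j * (majorant_mass (sg y) * s j ^+ 2).
  by rewrite /scale_term /weight -/(s j); ring.
rewrite ge0_integralZl_EFin //; last 2 first.
- by move=> z _; exact: majorant_ge0.
- exact: measurable_majorant.
rewrite [leRHS]EFinM lee_wpmul2l ?lee_fin //.
exact: integral_majorant_le mdisk (pole_scale_gt0 _ _ adm) (nonresonant_index _ _).
Qed.

Lemma disk_integral_le_scale_sum : exists2 C : R, 0 < C &
  forall x, admissible M x ->
    (disk_integral eps dl x <= (C * \sum_j scale_term M eps dl x j)%:E)%E.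
Proof.
pose sg (y : 'I_M.+1 * 'I_#|'I_N|) := radial_exponent eps dl y.1 y.2.+1.
pose mass := \sum_y majorant_mass (sg y).
have mass0 : 0 <= mass.
  by apply: sumr_ge0 => y _; apply: majorant_mass_ge0; exact: nonresonant_index.
have const0 : 0 < pointwise_const.
  by rewrite !mulr_gt0 ?powR_gt0 ?mulr_gt0 ?exprn_gt0.
exists (pointwise_const * (1 + mass)) => [|x adm].
  by rewrite mulr_gt0 ?ltr_pwDl.
apply: le_trans (disk_integral_le_mass_sum adm) _; rewrite lee_fin.
rewrite -(pair_bigA _ (fun j y => pointwise_const * majorant_mass (sg y) *
  scale_term M eps dl x j)) /=.
rewrite mulr_sumr; apply: ler_sum => j _; rewrite -mulr_suml -mulr_sumr.
by rewrite ler_wpM2r ?scale_term_ge0 // ler_pM2l // lerDr.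
Qed.

End UpperBound.

(** * Comparison of the integral with the sum over the scales *)

Section IntegralAsymp.
Variables (R : realType) (M N : nat) (eps dl : R).
Hypotheses (eps0 : 0 <= eps) (dl0 : 0 <= dl) (dl2 : dl < 2) (N0 : (0 < N)%N).
Hypothesis nonresonant : forall nu k : nat, (nu <= M)%N -> (k < N)%N ->
  radial_exponent eps dl nu k.+1 + 2 != 0.
Implicit Types (x : pole_config R N).

Lemma disk_integral_fin_num x :
  admissible M x -> disk_integral eps dl x \is a fin_num.
Proof.
have [C _ le_C] := disk_integral_le_scale_sum eps0 dl0 dl2 N0 nonresonant => adm.
rewrite ge0_fin_numE ?disk_integral_ge0 //.
by apply: le_lt_trans (le_C x adm) _; rewrite ltry.
Qed.

Lemma disk_integral_asymp :
  asymp (@admissible R M N) (fun x => fine (disk_integral eps dl x))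
    (fun x => \sum_j scale_term M eps dl x j).
Proof.
have sum_ge0 x : 0 <= \sum_j scale_term M eps dl x j.
  by apply: sumr_ge0 => j _; exact: scale_term_ge0.
split.
  have [C C0 le_C] := disk_integral_le_scale_sum eps0 dl0 dl2 N0 nonresonant.
  exists C => // x adm; rewrite fine_ge0 ?disk_integral_ge0 //= -lee_fin fineK.
    exact: le_C.
  exact: disk_integral_fin_num.
have [c c0 ge_c] := @disk_integral_ge_scale_term R M N eps dl eps0 dl0.
have J0 : 0 < #|{: 'I_N * 'I_N}|%:R :> R.
  by rewrite ltr0n; apply/card_gt0P; exists (Ordinal N0, Ordinal N0).
exists (#|{: 'I_N * 'I_N}|%:R / c) => [|x adm]; first exact: divr_gt0.
rewrite sum_ge0 /= -mulrA mulr_natl -sumr_const; apply: ler_sum => j _.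
rewrite ler_pdivlMl // -lee_fin fineK; first exact: ge_c.
exact: disk_integral_fin_num.
Qed.

End IntegralAsymp.

(** * Quotients of sums of moduli of integer polynomials *)

Section AbsSummable.
Variables (R : realType) (m N : nat).
Implicit Types (x : pole_config R N) (f g : pole_config R N -> R) (e : bipoly m N).

Definition numer_coef x (i : 'I_m) : R[i] := (numer x)`_i.

Definition abs_summable f : Prop := exists s : seq (bipoly m N),
  forall x, (size (numer x) <= m)%N -> abs_sum s (numer_coef x) (pole x) = f x.

Lemma abs_summable_normc e :
  abs_summable (fun x => normc (bieval (numer_coef x) (pole x) e)).
Proof. by exists [:: e] => x _; rewrite /abs_sum big_seq1. Qed.

Lemma eq_abs_summable f g : (forall x, (size (numer x) <= m)%N -> f x = g x) ->
  abs_summable f -> abs_summable g.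
Proof. by move=> fg [s fE]; exists s => x size_x; rewrite fE ?fg. Qed.

Lemma abs_summable0 : abs_summable (fun=> 0).
Proof. by exists [::] => x _; rewrite /abs_sum big_nil. Qed.

Lemma abs_summable_nat n : abs_summable (fun=> n%:R).
Proof.
apply: eq_abs_summable (abs_summable_normc n%:R) => x _.
by rewrite rmorph_nat normcMn Normc.normc1.
Qed.

Lemma abs_summableD f g : abs_summable f -> abs_summable g ->
  abs_summable (fun x => f x + g x).
Proof.
move=> [s fE] [t gE]; exists (s ++ t) => x size_x.
by rewrite /abs_sum big_cat /= -fE // -gE.
Qed.

Lemma abs_summableM f g : abs_summable f -> abs_summable g ->
  abs_summable (fun x => f x * g x).
Proof.
move=> [s fE] [t gE]; exists [seq e1 * e2 | e1 <- s, e2 <- t] => x size_x.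
rewrite /abs_sum big_allpairs_dep -fE // -gE // mulr_suml; apply: eq_bigr => e1 _.
by rewrite mulr_sumr; apply: eq_bigr => e2 _; rewrite rmorphM Normc.normcM.
Qed.

Lemma abs_summableX f n : abs_summable f -> abs_summable (fun x => f x ^+ n).
Proof.
move=> sf; elim: n => [|n IH]; first exact: (abs_summable_nat 1).
by apply: eq_abs_summable (abs_summableM sf IH) => x _; rewrite exprS.
Qed.

Lemma abs_summable_sum (I : Type) (r : seq I) (P : pred I)
    (f : I -> pole_config R N -> R) : (forall i, abs_summable (f i)) ->
  abs_summable (fun x => \sum_(i <- r | P i) f i x).
Proof.
move=> sf; elim: r => [|i r IH].
  by apply: eq_abs_summable abs_summable0 => x _; rewrite big_nil.
have [Pi|nPi] := boolP (P i).
  by apply: eq_abs_summable (abs_summableD (sf i) IH) => x _; rewrite big_cons Pi.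
by apply: eq_abs_summable IH => x _; rewrite big_cons (negPf nPi).
Qed.

Lemma abs_summable_prod (I : Type) (r : seq I) (P : pred I)
    (f : I -> pole_config R N -> R) : (forall i, abs_summable (f i)) ->
  abs_summable (fun x => \prod_(i <- r | P i) f i x).
Proof.
move=> sf; elim: r => [|i r IH].
  by apply: eq_abs_summable (abs_summable_nat 1) => x _; rewrite big_nil.
have [Pi|nPi] := boolP (P i).
  by apply: eq_abs_summable (abs_summableM (sf i) IH) => x _; rewrite big_cons Pi.
by apply: eq_abs_summable IH => x _; rewrite big_cons (negPf nPi).
Qed.

Lemma abs_summable_nderivn nu i :
  abs_summable (fun x => normc (numer x)^`N(nu).[pole x i]).
Proof.
pose p : {poly bipoly m N} := \poly_(k < m) oapp (inner_var N) 0 (insub k).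
apply: eq_abs_summable (abs_summable_normc p^`N(nu).[outer_var m i]) => x size_x.
rewrite -horner_map -nderivn_map /= bieval_outer; congr (normc _^`N(nu).[_]).
apply/polyP => k; rewrite coef_map coef_poly; case: ltnP => [lt_k|le_k].
  by rewrite insubT /= bieval_inner.
by rewrite raddf0 nth_default // (leq_trans size_x).
Qed.

Lemma abs_summable_pole_dist i j : abs_summable (fun x => pole_dist x i j).
Proof.
apply: eq_abs_summable (abs_summable_normc (outer_var m i - outer_var m j)) => x _.
by rewrite rmorphB /= !bieval_outer.
Qed.

Lemma abs_summable_pole_scale i l : abs_summable (fun x => pole_scale x i l).
Proof.
rewrite /pole_scale /dist_scale; case: eqP => _; first exact: abs_summable_nat.
exact: abs_summable_pole_dist.
Qed.

End AbsSummable.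

Section ScaleQuotient.
Variables (R : realType) (M N m pn qn : nat).
Hypotheses (N0 : (0 < N)%N) (m0 : (0 < m)%N).
Let eps : R := pn%:R / m%:R.
Let dl : R := qn%:R / m%:R.
Implicit Types (x : pole_config R N) (j : 'I_N * 'I_N).

Definition scale_numer x j : R := let s := pole_scale x j.1 j.2 in
  monomial_sum (taylor_coef M x j.1) s ^+ pn * s ^+ (2 * m).

Definition scale_denom x j : R := pole_product x j.1 (pole_scale x j.1 j.2) ^+ qn.

Definition common_denom x : R := \prod_j scale_denom x j.

Definition common_numer x : R :=
  \sum_j scale_numer x j * \prod_(k | k != j) scale_denom x k.

Lemma abs_summable_scale_denom j : abs_summable M.+1 (fun x => scale_denom x j).
Proof.
apply/abs_summableX/abs_summable_prod => k.
apply: abs_summableD; first exact: abs_summable_pole_scale.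
exact: abs_summable_pole_dist.
Qed.

Lemma abs_summable_common_denom : abs_summable M.+1 common_denom.
Proof. exact/abs_summable_prod/abs_summable_scale_denom. Qed.

Lemma abs_summable_common_numer : abs_summable M.+1 common_numer.
Proof.
have scale_sum i l := @abs_summable_pole_scale R M.+1 N i l.
apply: abs_summable_sum => j; apply: abs_summableM; last first.
  exact/abs_summable_prod/abs_summable_scale_denom.
apply: abs_summableM; apply: abs_summableX => //; apply: abs_summable_sum => nu.
by apply: abs_summableM; [exact: abs_summable_nderivn|exact: abs_summableX].
Qed.

Lemma scale_denom_gt0 x j : admissible M x -> 0 < scale_denom x j.
Proof.
by move=> adm; rewrite exprn_gt0 // pole_product_gt0 // (pole_scale_gt0 _ _ adm).
Qed.

Lemma common_denom_gt0 x : admissible M x -> 0 < common_denom x.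
Proof. by move=> adm; apply: prodr_gt0 => j _; exact: scale_denom_gt0. Qed.

Lemma monomial_sum_taylor_gt0 x i r : admissible M x -> 0 < r ->
  0 < monomial_sum (taylor_coef M x i) r.
Proof.
move=> adm r0; have := numer_neq0 adm; have := size_numer adm.
set p := numer x => size_p p0.
have lt_deg : ((size p).-1 < M.+1)%N by rewrite prednK ?size_poly_gt0.
rewrite /monomial_sum (bigD1 (Ordinal lt_deg)) //= ltr_pwDl //; last first.
  by apply: sumr_ge0 => nu _; rewrite mulr_ge0 ?exprn_ge0 ?taylor_coef_ge0 // ltW.
rewrite mulr_gt0 ?exprn_gt0 // normc_gt0 -/p /=.
have -> : p^`N((size p).-1) = (lead_coef p)%:P.
  apply/polyP => k; rewrite coef_nderivn coefC; case: k => [|k].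
    by rewrite addn0 binn mulr1n.
  by rewrite nth_default ?mul0rn // addnS -addSn prednK ?size_poly_gt0 // leq_addr.
by rewrite hornerC lead_coef_eq0.
Qed.

Lemma common_numer_gt0 x : admissible M x -> 0 < common_numer x.
Proof.
move=> adm.
have term_gt0 j : 0 < scale_numer x j * \prod_(k | k != j) scale_denom x k.
  have s0 := pole_scale_gt0 j.1 j.2 adm; rewrite !mulr_gt0 ?exprn_gt0 //.
    exact: monomial_sum_taylor_gt0.
  by apply: prodr_gt0 => k _; exact: scale_denom_gt0.
rewrite /common_numer (bigD1 (Ordinal N0, Ordinal N0)) //= ltr_pwDl //.
by apply: sumr_ge0 => j _; exact: ltW.
Qed.

Lemma scale_term_pow x j : admissible M x ->
  scale_term M eps dl x j ^+ m = scale_numer x j / scale_denom x j.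
Proof.
move=> adm; have s0 := pole_scale_gt0 j.1 j.2 adm.
have powR_div (y : R) k : 0 <= y -> (y `^ (k%:R / m%:R)) ^+ m = y ^+ k.
  move=> y0; rewrite -powR_mulrn ?powR_ge0 // -powRrM divfK ?powR_mulrn //.
  by rewrite pnatr_eq0 -lt0n.
rewrite /scale_term /local_weight exprMn expr_div_n !powR_div -?exprM 1?mulrAC //.
  exact/ltW/pole_product_gt0.
by apply: monomial_sum_ge0; [exact: taylor_coef_ge0|exact: ltW].
Qed.

Lemma sum_scale_term_pow x : admissible M x ->
  \sum_j scale_term M eps dl x j ^+ m = common_numer x / common_denom x.
Proof.
move=> adm; rewrite /common_numer mulr_suml; apply: eq_bigr => j _.
rewrite scale_term_pow // /common_denom [X in _ = _ / X](bigD1 j) //= invfM mulrACA.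
by rewrite divff ?mulr1 // gt_eqF // prodr_gt0 // => k _; exact: scale_denom_gt0.
Qed.

End ScaleQuotient.

Section Symmetrization.
Variables (R : realType) (M N m pn qn : nat).
Hypotheses (N0 : (0 < N)%N) (m0 : (0 < m)%N).
Let eps : R := pn%:R / m%:R.
Let dl : R := qn%:R / m%:R.
Hypothesis dl2 : dl < 2.
Hypothesis nonresonant : forall nu k : nat, (nu <= M)%N -> (k < N)%N ->
  radial_exponent eps dl nu k.+1 + 2 != 0.
Let D : set (pole_config R N) := @admissible R M N.
Implicit Types (x : pole_config R N) (t : 'S_N).

Definition permute_poles t x : pole_config R N :=
  PoleConfig (numer x) (denom x) (pole x \o t).

Lemma admissible_permute t x : admissible M x -> admissible M (permute_poles t x).
Proof.
move=> [p0 sp qE lead small inj]; split => //=.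
- by rewrite (reindex_inj (@perm_inj _ t)) in qE.
- by move=> i j /inj; exact: perm_inj.
Qed.

Definition sym_numer x : R := \sum_t common_numer M m pn qn (permute_poles t x).

Definition sym_denom x : R := \sum_t common_denom qn (permute_poles t x).

Lemma sym_numer_gt0 x : D x -> 0 < sym_numer x.
Proof.
move=> Dx; have term_gt0 t := common_numer_gt0 _ _ _ N0 (admissible_permute t Dx).
by rewrite /sym_numer (bigD1 1%g) //= ltr_pwDl // sumr_ge0 // => t _; exact: ltW.
Qed.

Lemma sym_denom_gt0 x : D x -> 0 < sym_denom x.
Proof.
move=> Dx; have term_gt0 t := common_denom_gt0 _ (admissible_permute t Dx).
by rewrite /sym_denom (bigD1 1%g) //= ltr_pwDl // sumr_ge0 // => t _; exact: ltW.
Qed.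

Lemma disk_integral_pow_asymp :
  asymp D (fun x => fine (disk_integral eps dl x) ^+ m * common_denom qn x)
    (common_numer M m pn qn).
Proof.
have eps0 : 0 <= eps by rewrite divr_ge0.
have dl0 : 0 <= dl by rewrite divr_ge0.
have integral_asymp := asympX m (disk_integral_asymp eps0 dl0 dl2 N0 nonresonant).
have power_asymp := asymp_power_sum (D := D) (Ordinal N0, Ordinal N0) m
  (fun j x _ => scale_term_ge0 M eps dl x j).
have denom_asymp : asymp D (@common_denom R N qn) (@common_denom R N qn).
  by apply: asymp_refl => x Dx; rewrite ltW // (common_denom_gt0 _ Dx).
have integral_power := asymp_trans integral_asymp power_asymp.
apply: eq_asymp (asympM integral_power denom_asymp) => // x Dx.
by rewrite sum_scale_term_pow // divfK // gt_eqF // (common_denom_gt0 _ Dx).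
Qed.

(* The integral does not depend on the ordering of the poles, so the estimate can be
   summed over all permutations. *)
Lemma disk_integral_sym_asymp :
  asymp D (fun x => fine (disk_integral eps dl x))
    (fun x => sym_numer x `^ m%:R^-1 / sym_denom x `^ m%:R^-1).
Proof.
have mV0 : 0 <= m%:R^-1 :> R by rewrite invr_ge0.
have sum_asymp := asymp_sum (index_enum 'S_N)
  (fun t => asymp_comp (admissible_permute t) disk_integral_pow_asymp).
have denomV : asymp D (fun x => (sym_denom x)^-1) (fun x => (sym_denom x)^-1).
  by apply: asymp_refl => x Dx; rewrite invr_ge0 ltW ?sym_denom_gt0.
apply: eq_asymp (asymp_powR mV0 (asympM sum_asymp denomV)) => x Dx /=.
  rewrite [X in X / _](_ : _ = fine (disk_integral eps dl x) ^+ m * sym_denom x).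
    rewrite mulfK ?gt_eqF ?sym_denom_gt0 //.
    rewrite -powR_mulrn ?fine_ge0 ?disk_integral_ge0 // -powRrM mulfV.
      by rewrite powRr1 ?fine_ge0 ?disk_integral_ge0.
    by rewrite pnatr_eq0 -lt0n.
  by rewrite /sym_denom mulr_sumr.
rewrite powRM ?invr_ge0 ?ltW ?sym_numer_gt0 ?sym_denom_gt0 //; congr (_ * _).
by rewrite -!powR_inv1 ?powR_ge0 ?(ltW (sym_denom_gt0 Dx)) // -!powRrM mulrC.
Qed.

Definition config_coefs x : 'I_(M.+1 + N.+1) -> R[i] :=
  bcat (@numer_coef R M.+1 N x) (fun j : 'I_N.+1 => (denom x)`_j).

Definition sq_sum (ps : seq (intpoly (M.+1 + N.+1))) x : R :=
  \sum_(p <- ps) normc (ipeval p (config_coefs x)) ^+ 2.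

Lemma denom_lead x : D x -> (denom x)`_N = lead_coef (denom x).
Proof.
move=> Dx; rewrite lead_coefE; congr (_`_ _); rewrite (denomE Dx).
rewrite size_scale ?(lead_denom_neq0 Dx) // size_prod_XsubC.
by rewrite -[index_enum _]enumT size_enum_ord.
Qed.

Lemma sq_sum_asymp f : abs_summable M.+1 f ->
  exists (ps : seq (intpoly (M.+1 + N.+1))) (h : nat), (0 < h)%N /\
    asymp D (sq_sum ps) (fun x => (\sum_t f (permute_poles t x)) ^+ (2 * h)).
Proof.
move=> [s fE].
have lead1 : asymp D (fun x => normc (denom x)`_(@ord_max N)) (fun=> 1).
  split; exists 2 => // x Dx; have := normc_lead_denom Dx; rewrite /= denom_lead //.
    by rewrite normc_ge0 mulr1 => /andP[].
  by rewrite ler01; lra.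
have [|ps [h [h0 ps_asymp]]] := @sym_abs_sum_asymp R M.+1 N _ D
    (@numer_coef R M.+1 N) (fun x (j : 'I_N.+1) => (denom x)`_j) (@pole R N)
    lead1 _ s.
  move=> x j Dx; rewrite /= denom_lead // {1}(denomE Dx) coefZ mulrC mulKf //.
  exact: lead_denom_neq0 Dx.
exists ps, h; split => //; apply: eq_asymp ps_asymp => // x Dx; congr (_ ^+ _).
by apply: eq_bigr => t _; rewrite -fE //=; exact: size_numer Dx.
Qed.

Lemma powR_sq_sum_asymp ps h (f : pole_config R N -> R) :
  (0 < h)%N -> (forall x, D x -> 0 < f x) ->
  asymp D (sq_sum ps) (fun x => f x ^+ (2 * h)) ->
  asymp D (fun x => sq_sum ps x `^ ((h * m)%:R^-1 / 2)) (fun x => f x `^ m%:R^-1).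
Proof.
move=> h0 f0 ps_asymp.
have exponent0 : 0 <= (h * m)%:R^-1 / 2 :> R by rewrite divr_ge0 ?invr_ge0.
apply: eq_asymp (asymp_powR exponent0 ps_asymp) => // x Dx.
rewrite -powR_mulrn ?(ltW (f0 x Dx)) // -powRrM; congr (_ `^ _); rewrite !natrM.
by field; rewrite !pnatr_eq0 -!lt0n h0 m0.
Qed.

Lemma disk_integral_sq_sum_asymp :
  exists (ps qs : seq (intpoly (M.+1 + N.+1))) (h h' : nat),
  [/\ forall x, D x -> 0 < sq_sum ps x, forall x, D x -> 0 < sq_sum qs x &
      asymp D (fun x => fine (disk_integral eps dl x))
        (fun x => sq_sum ps x `^ ((h * m)%:R^-1 / 2) /
                  sq_sum qs x `^ ((h' * m)%:R^-1 / 2))].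
Proof.
have [ps [h [h0 ps_asymp]]] :=
  sq_sum_asymp (@abs_summable_common_numer R M N m pn qn).
have [qs [h' [h'0 qs_asymp]]] :=
  sq_sum_asymp (@abs_summable_common_denom R M N qn).
exists ps, qs, h, h'; split => // [x Dx|x Dx|].
- by apply: (asymp_gt0 ps_asymp Dx); rewrite exprn_gt0 ?sym_numer_gt0.
- by apply: (asymp_gt0 qs_asymp Dx); rewrite exprn_gt0 ?sym_denom_gt0.
apply: asymp_trans disk_integral_sym_asymp _; apply: asymp_sym; apply: asympM.
  exact: powR_sq_sum_asymp sym_numer_gt0 ps_asymp.
exact/asympV/(powR_sq_sum_asymp h'0 sym_denom_gt0 qs_asymp).
Qed.

End Symmetrization.

(** * Polynomials with simple roots near ['X^N] *)

Section SimpleRootsNearXn.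
Variable R : realType.
Implicit Types (q : {poly R[i]}) (w : R[i]).

Lemma coef_coefpoly m (b : 'I_m -> R[i]) (j : 'I_m) : (coefpoly b)`_j = b j.
Proof.
have coefE : (if (j < m)%N =P true is ReflectT h then b (Ordinal h) else 0) = b j.
  by case: eqP => [h|]; [congr b; exact: val_inj|rewrite ltn_ord].
by rewrite coef_poly coefE ltn_ord.
Qed.

Lemma size_coefpoly m (b : 'I_m -> R[i]) : (size (coefpoly b) <= m)%N.
Proof. exact: size_poly. Qed.

Lemma normc_root_near_Xn q N (rho : R) w : (size q <= N.+1)%N ->
  0 <= rho <= 1 -> tnorm (q - 'X^N) < rho ^+ N -> root q w -> normc w <= rho.
Proof.
move=> size_q /andP[rho0 rho1] near_Xn /rootP qw; rewrite leNgt; apply/negP => lt_w.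
have size_diff : (size (q - 'X^N)%R <= N.+1)%N.
  rewrite (leq_trans (size_polyD _ _)) // size_polyN size_polyXn.
  by rewrite geq_max size_q leqnn.
have := le_normc_horner w size_diff.
rewrite !hornerE qw sub0r normcN normcX; set t := tnorm _ in near_Xn *.
have rhoN : rho ^+ N <= 1 by exact: exprn_ile1.
have [w1|/ltW w1] := leP (normc w) 1.
  rewrite expr1n mulr1 leNgt => /negP; apply; apply: lt_le_trans near_Xn _.
  by rewrite lerXn2r ?nnegrE ?normc_ge0 // ltW.
rewrite leNgt => /negP; apply; rewrite gtr_pMl ?(lt_le_trans near_Xn) //.
by rewrite exprn_gt0 // (lt_le_trans ltr01).
Qed.

Lemma simple_roots_factor q : q != 0 -> simple_roots q ->
  exists2 r : seq R[i], uniq r & q = lead_coef q *: \prod_(w <- r) ('X - w%:P).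
Proof.
move=> q0 simple_q; have [r qE] := closed_field_poly_normal q.
exists r => //; apply: count_mem_uniq => w; rewrite -mu_prod_XsubC.
have root_r : root q w = (w \in r).
  by rewrite qE rootZ ?lead_coef_eq0 // root_prod_XsubC.
have -> : mup w (\prod_(z <- r) ('X - z%:P)) = mup w q.
  by rewrite [in RHS]qE -mul_polyC mupMr // rootC lead_coef_eq0.
case: (boolP (w \in r)) => wr; first by rewrite simple_q // root_r.
by rewrite mupNroot // root_r.
Qed.

Lemma lead_near_Xn q N : (size q <= N.+1)%N -> tnorm (q - 'X^N) <= 1 / 4 ->
  lead_coef q = q`_N /\ 1 / 2 <= normc (lead_coef q) <= 2.
Proof.
move=> size_q near_Xn; have near1 : normc (q`_N - 1) <= 1 / 4.
  have -> : q`_N - 1 = (q - 'X^N)`_N by rewrite coefB coefXn eqxx.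
  exact: le_trans (le_normc_coef_tnorm _ _) near_Xn.
have lo : 1 / 2 <= normc q`_N.
  by have := le_normcB q`_N (q`_N - 1); rewrite subKr Normc.normc1; lra.
have up : normc q`_N <= 2.
  by have := le_normcD (q`_N - 1) 1; rewrite subrK Normc.normc1; lra.
suff -> : lead_coef q = q`_N by rewrite lo up.
suff size_qE : size q = N.+1 by rewrite lead_coefE size_qE.
apply/eqP; rewrite eqn_leq size_q ltnNge; apply: contraTN lo => le_qN.
by rewrite nth_default // Normc.normc0 -ltNge.
Qed.

End SimpleRootsNearXn.

Section AdmissibleConfigurations.
Variables (R : realType) (M N : nat).
Hypothesis N0 : (0 < N)%N.

Lemma admissible_of_simple_roots (b1 : 'I_M.+1 -> R[i]) (b2 : 'I_N.+1 -> R[i]) :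
  (exists j, b1 j != 0) -> tnorm (coefpoly b2 - 'X^N) < (1 / 4) ^+ N ->
  simple_roots (coefpoly b2) ->
  exists a : 'I_N -> R[i], admissible M (PoleConfig (coefpoly b1) (coefpoly b2) a).
Proof.
move=> [j b1j] near_Xn simple_q; set q := coefpoly b2 in near_Xn simple_q *.
have size_q : (size q <= N.+1)%N by exact: size_coefpoly.
have [|lead_q lead_bounds] := lead_near_Xn size_q.
  by rewrite (le_trans (ltW near_Xn)) // -[leRHS]expr1 ler_wiXn2l //; lra.
have lead0 : lead_coef q != 0 by rewrite -normc_gt0; lra.
have q0 : q != 0 by rewrite -lead_coef_eq0.
have [r uniq_r qE] := simple_roots_factor q0 simple_q.
have size_r : size r = N.
  have size_q_eq : size q = (size r).+1 by rewrite qE size_scale // size_prod_XsubC.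
  apply/eqP; rewrite -eqSS -size_q_eq eqn_leq size_q ltnNge.
  by apply: contraNN lead0 => le_qN; rewrite lead_q nth_default.
have prodE : \prod_(w <- r) ('X - w%:P) = \prod_(i < N) ('X - (r`_i)%:P).
  by rewrite (big_nth 0) size_r big_mkord.
exists (fun i => r`_i); split => //=.
- by apply: contraNneq b1j => p0; rewrite -(coef_coefpoly b1) p0 coef0.
- exact: size_coefpoly.
- by rewrite -prodE.
- move=> i; apply: (normc_root_near_Xn size_q _ near_Xn); first lra.
  by rewrite qE rootZ // root_prod_XsubC mem_nth // size_r.
- by move=> i k /eqP; rewrite nth_uniq ?size_r // => /eqP/val_inj.
Qed.

Lemma admissible_config_exists : exists x : pole_config R N, admissible M x.
Proof.
have N_gt0 : 0 < N%:R :> R by rewrite ltr0n.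
pose a (i : 'I_N) : R := i%:R / (4 * N%:R).
pose q : {poly R[i]} := \prod_(i < N) ('X - ((a i)%:C)%C%:P).
have q_monic : q \is monic by exact: monic_prod_XsubC.
exists (PoleConfig 1 q (fun i => (a i)%:C%C)); split.
- exact: oner_neq0.
- by rewrite size_poly1.
- by rewrite /= (monicP q_monic) scale1r.
- by rewrite (monicP q_monic) Normc.normc1; lra.
- move=> i; rewrite -[pole _ i]/((a i)%:C)%C normc_real.
  rewrite ger0_norm ?divr_ge0 ?mulr_ge0 //.
  by rewrite ler_pdivrMr ?mulr_gt0 // mulrA divfK // mul1r ler_nat ltnW.
- move=> i k /complexI/(mulIf _) eq_ik; apply/val_inj/eqP.
  rewrite -(eqr_nat R) eq_ik //.
  by rewrite invr_eq0 gt_eqF // mulr_gt0.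
Qed.

End AdmissibleConfigurations.

Lemma rat_common_denominator (x y : rat) : 0 <= x -> 0 <= y ->
  exists m p q : nat, [/\ (0 < m)%N, x = p%:R / m%:R & y = q%:R / m%:R].
Proof.
have nat_fraction (z : rat) : 0 <= z ->
    exists n d : nat, (0 < d)%N /\ z = n%:R / d%:R.
  move=> z0; exists `|numq z|%N, `|denq z|%N.
  rewrite absz_gt0 denq_eq0; split => //.
  rewrite -[LHS]divq_num_den -[in LHS](gez0_abs (_ : 0 <= numq z)) ?numq_ge0 //.
  by rewrite -[in LHS](gez0_abs (_ : 0 <= denq z)) ?denq_ge0 // !pmulrn.
move=> /nat_fraction[n1 [d1 [d10 ->]]] /nat_fraction[n2 [d2 [d20 ->]]].
exists (d1 * d2)%N, (n1 * d2)%N, (n2 * d1)%N; rewrite muln_gt0 d10 d20 !natrM.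
by split => //; field; rewrite !pnatr_eq0 -!lt0n d10 d20.
Qed.

(** * The absolute rational power *)

Section AbsoluteRationalPower.
Variables (R : realType) (M N : nat) (eps delta : rat).
Hypotheses (eps0 : 0 <= eps) (delta0 : 0 <= delta) (delta2 : delta < 2).
Hypothesis N0 : (0 < N)%N.
Hypothesis nonresonant : forall nu k : nat, (nu <= M)%N -> (k < N)%N ->
  nu%:R * eps - (N - k)%:R * delta + 2 != 0 :> rat.

Lemma nonresonant_ratr (nu k : nat) : (nu <= M)%N -> (k < N)%N ->
  radial_exponent (ratr eps : R) (ratr delta) nu k.+1 + 2 != 0.
Proof.
move=> le_nu lt_k; have lt_rev : (N - k.+1 < N)%N by rewrite ltn_subrL.
have := nonresonant le_nu lt_rev; rewrite subKn //; apply: contraNneq => sg2.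
apply/eqP/(fmorph_inj (@ratr R)).
by rewrite rmorph0 -[RHS]sg2 rmorphD rmorphB !rmorphM /= !ratr_nat.
Qed.

Lemma sq_sum_gt0_nonzero (ps : seq (intpoly (M.+1 + N.+1))) (x : pole_config R N) :
  0 < sq_sum ps x ->
  exists2 p, p \in ps & ~~ ip_is_zero p.
Proof.
move=> ps_gt0; apply/hasP; apply: contraTT ps_gt0 => /hasPn all_zero.
rewrite /sq_sum big_seq big1 ?ltxx // => p /all_zero; rewrite negbK => p0.
by rewrite ipeval_eq0 // Normc.normc0 expr0n.
Qed.

Lemma disk_integral_asymp_arp : exists T : ARP (M.+1 + N.+1),
  (forall x : pole_config R N, admissible M x -> arp_strict_dom T (config_coefs x)) /\
  asymp (@admissible R M N)
    (fun x => fine (disk_integral (ratr eps) (ratr delta) x))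
    (fun x => arp_eval T (config_coefs x)).
Proof.
have [m [pn [qn [m0 epsE deltaE]]]] := rat_common_denominator eps0 delta0.
have epsR : ratr eps = pn%:R / m%:R :> R by rewrite epsE fmorph_div /= !ratr_nat.
have deltaR : ratr delta = qn%:R / m%:R :> R.
  by rewrite deltaE fmorph_div /= !ratr_nat.
have deltaR2 : qn%:R / m%:R < 2 :> R by rewrite -deltaR -(ratr_nat R 2) ltr_rat.
have := nonresonant_ratr; rewrite epsR deltaR => nonresonantR.
have [ps [qs [h [h' [ps0 qs0 quotient]]]]] :=
  disk_integral_sq_sum_asymp N0 m0 deltaR2 nonresonantR.
have [x0 adm0] := admissible_config_exists R M N0.
have eps'0 : 0 <= (h * m)%:R^-1 :> rat by rewrite invr_ge0.
have delta'0 : 0 <= (h' * m)%:R^-1 :> rat by rewrite invr_ge0.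
exists (MkARP qs eps'0 delta'0 (sq_sum_gt0_nonzero (ps0 x0 adm0))).
have ratrV n : ratr n%:R^-1 = n%:R^-1 :> R by rewrite fmorphV /= ratr_nat.
rewrite /arp_strict_dom /arp_eval /arp_K /arp_L /= !ratrV; split=> // x adm.
by rewrite !gt_eqF ?powR_gt0 ?ps0 ?qs0.
Qed.

End AbsoluteRationalPower.

Lemma config_coefs_coefpoly (R : realType) M N (b1 : 'I_M.+1 -> R[i])
    (b2 : 'I_N.+1 -> R[i]) (a : 'I_N -> R[i]) :
  config_coefs (PoleConfig (coefpoly b1) (coefpoly b2) a) = bcat b1 b2.
Proof. by congr bcat; apply/funext => j; exact: coef_coefpoly. Qed.

Theorem theorem5 (R : realType) (eps delta : rat) (M N : nat) :
  0 <= eps -> 0 <= delta -> delta < 2 -> (0 < N)%N ->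
  (forall nu k : nat, (nu <= M)%N -> (k < N)%N ->
     nu%:R * eps - (N - k)%:R * delta + 2 != 0 :> rat) ->
  exists (T : ARP (M.+1 + N.+1)) (s1 : R), 0 < s1 < 1 /\
  exists c C : R, 0 < c /\ 0 < C /\
  forall (b1 : 'I_M.+1 -> R[i]) (b2 : 'I_N.+1 -> R[i]),
    (exists j, b1 j != 0) ->
    tnorm (coefpoly b2 - 'X^N) < s1 ->
    simple_roots (coefpoly b2) ->
    arp_strict_dom T (bcat b1 b2) /\
    let I := (\int[@lebC R]_(p in @unit_disk R)
               (powR (Normc.normc (coefpoly b1).[cplx p]) (ratr eps) /
                powR (Normc.normc (coefpoly b2).[cplx p]) (ratr delta))%:E)%E in
    ((c * arp_eval T (bcat b1 b2))%:E <= I /\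
     I <= (C * arp_eval T (bcat b1 b2))%:E)%E.
Proof.
move=> eps0 delta0 delta2 N0 nonres.
have [T [strict_dom [[C C0 le_C] [c c0 le_c]]]] :=
  disk_integral_asymp_arp R eps0 delta0 delta2 N0 nonres.
exists T, ((1 / 4) ^+ N); split.
  by rewrite exprn_gt0 //= exprn_ilt1 -?lt0n //; lra.
exists c^-1, C; split; first by rewrite invr_gt0.
split=> // b1 b2 b1_neq0 near_Xn simple_q.
have [a adm] := admissible_of_simple_roots N0 b1_neq0 near_Xn simple_q.
rewrite -(config_coefs_coefpoly b1 b2 a); split; first exact: strict_dom.
have I_fin : disk_integral (ratr eps) (ratr delta)
    (PoleConfig (coefpoly b1) (coefpoly b2) a) \is a fin_num.
  apply: (disk_integral_fin_num _ _ _ N0 _ adm); last exact: nonresonant_ratr.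
  - by rewrite ler0q.
  - by rewrite ler0q.
  - by rewrite -(ratr_nat R 2) ltr_rat.
have /andP[_ I_le] := le_C _ adm; have /andP[_ I_ge] := le_c _ adm.
by rewrite /= -[X in (_ <= X /\ X <= _)%E](fineK I_fin) !lee_fin ler_pdivrMl.
Qed.
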